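(* The following groups embed in Thompson's group $V$: (1) the group $V_{(H,\theta)}$, for every finite group $H$ and every endomorphism $\theta\in\mathrm{End}(H)$; (2) the FSS group $G(\mathrm{Sim}_X)$, for every compact ultrametric space $X$ and every finite similarity structure $\mathrm{Sim}_X$ on $X$ with finitely many similarity classes of balls.
   Context: Thompson's group $V$: let $\mathfrak C=\{0,1\}^{\infty}$ be the Cantor set, and for $a\in\{0,1\}^*$ let $[a]=\{a\eta:\eta\in\{0,1\}^\infty\}$. $V$ is the group of all homeomorphisms of $\mathfrak C$ of the form $a_j\eta\mapsto b_j\eta$ ($\eta\in\{0,1\}^\infty$, $j=1,\dots,m$), where $\mathfrak C=[a_1]\sqcup\dots\sqcup[a_m]=[b_1]\sqcup\dots\sqcup[b_m]$. The group $V_{(H,\theta)}$: let $H$ be a group and $\theta\in\mathrm{End}(H)$ (acting on the right). Elements of $V_{(H,\theta)}$ are represented by finite sets of triplets $\{(a_i,b_i,h_i):i=1,\dots,m\}$ with $\mathfrak C=[a_1]\sqcup\dots\sqcup[a_m]=[b_1]\sqcup\dots\sqcup[b_m]$ and $h_i\in H$, modulo the equivalence relation generated by replacing a triplet $(a_i,b_i,h_i)$ by the two triplets $(a_i0,b_i0,h_i)$ and $(a_i1,b_i1,(h_i)\theta)$. To multiply two elements, pass to equivalent representatives of the form $g_1=\{(a_i,b_i,h_i)\}$ and $g_2=\{(b_i,d_i,k_i)\}$, and set $g_1g_2=\{(a_i,d_i,h_ik_i)\}$. Finite similarity structures: a similarity between metric spaces is a map $h$ for which there is $\lambda>0$ with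 $d(xh,yh)=\lambda d(x,y)$ for all $x,y$. A finite similarity structure $\mathrm{Sim}_X$ on a compact ultrametric space $X$ assigns to each pair $B_1,B_2$ of open balls of $X$ a finite (possibly empty) set $\mathrm{Sim}_X(B_1,B_2)$ of surjective similarities $B_1\to B_2$, such that the balls with these maps form a groupoid (identities belong to $\mathrm{Sim}_X(B,B)$; closed under composition and inverses), and closed under restriction: if $h\in\mathrm{Sim}_X(B_1,B_2)$ and $B_3\subseteq B_1$ is a ball, then $h|_{B_3}\in\mathrm{Sim}_X(B_3,B_3h)$. Two balls $B_1,B_2$ are in the same similarity class if $\mathrm{Sim}_X(B_1,B_2)\neq\emptyset$. The FSS group $G(\mathrm{Sim}_X)$ is the group of homeomorphisms $h$ of $X$ such that every $x\in X$ lies in a ball $B'$ such that $B'h$ is a ball of $X$ and $h|_{B'}\in\mathrm{Sim}_X(B',B'h)$. *)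

(* Defs.v *)
From HB Require Import structures.
From mathcomp Require Import all_boot all_order all_algebra all_fingroup finmap generic_quotient.
From mathcomp Require Import all_classical all_reals all_analysis.
From Stdlib Require Import Relation_Operators.

Set Implicit Arguments.
Unset Strict Implicit.
Unset Printing Implicit Defensive.
Import Order.TTheory GRing.Theory Num.Theory.

Local Open Scope classical_set_scope.

Definition embeds (G K : groupType) : Prop :=
  exists f : {multiplicative G -> K}, injective f.

Record homeo (X : topologicalType) := Homeo {
  homeo_fun :> X -> X;
  homeo_inv : X -> X;
  homeoK : cancel homeo_fun homeo_inv;
  homeoVK : cancel homeo_inv homeo_fun;
  homeo_cont : continuous homeo_fun;
  homeo_inv_cont : continuous homeo_inv }.

Section HomeoGroup.
Variable X : topologicalType.
Implicit Types f g : homeo X.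

Lemma homeoP f g : f =1 g -> f = g.
Proof.
case: f g => [f fi fK fiK cf cfi] [g gi gK giK cg cgi] /= fg.
have /funext fgE := fg; subst g.
have : fi = gi by apply/funext => x; rewrite -{1}(giK x) fK.
by move=> ?; subst gi; congr Homeo; exact: Prop_irrelevance.
Qed.

HB.instance Definition _ := gen_eqMixin (homeo X).
HB.instance Definition _ := gen_choiceMixin (homeo X).

Definition homeo1 : homeo X.
Proof. by exists id id => // x; exact: cvg_id. Defined.

Definition homeoV f : homeo X.
Proof.
by exists (homeo_inv f) f; [exact: homeoVK|exact: homeoK
  |exact: homeo_inv_cont|exact: homeo_cont].
Defined.

(* Maps act on the right: the product [f * g] applies [f] first. *)
Definition homeoM f g : homeo X.
Proof.
exists (g \o f) (homeo_inv f \o homeo_inv g).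
- by move=> x /=; rewrite !homeoK.
- by move=> x /=; rewrite !homeoVK.
- by move=> x; apply: continuous_comp; apply: homeo_cont.
- by move=> x; apply: continuous_comp; apply: homeo_inv_cont.
Defined.

Lemma homeoMA : associative homeoM. Proof. by move=> f g h; exact: homeoP. Qed.
Lemma homeo1M : left_id homeo1 homeoM. Proof. by move=> f; exact: homeoP. Qed.
Lemma homeoM1 : right_id homeo1 homeoM. Proof. by move=> f; exact: homeoP. Qed.
Lemma homeoVM : left_inverse homeo1 homeoV homeoM.
Proof. by move=> f; apply: homeoP => x /=; rewrite homeoVK. Qed.
Lemma homeoMV : right_inverse homeo1 homeoV homeoM.
Proof. by move=> f; apply: homeoP => x /=; rewrite homeoK. Qed.

HB.instance Definition _ :=
  isGroup.Build (homeo X) homeoMA homeo1M homeoM1 homeoVM homeoMV.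

End HomeoGroup.

Definition word := seq bool.

Definition wcat (a : word) (x : cantor_space) : cantor_space :=
  fun n => if (n < size a)%N then nth false a n else x (n - size a)%N.

Definition cone (a : word) : set cantor_space := range (wcat a).

(* [\mathfrak C] is the disjoint union of the cones [cone (p t)], [t \in s],
   as an indexed family. *)
Definition cone_partition (T : choiceType) (p : T -> word) (s : {fset T}) :=
  trivIset [set` s] (cone \o p) /\
  \bigcup_(t in [set` s]) cone (p t) = [set: cantor_space].

Lemma wcat_cat a b x : wcat (a ++ b) x = wcat a (wcat b x).
Proof.
apply/funext => n; rewrite /wcat size_cat nth_cat.
case: ltnP => h; case: ltnP => h2 //.
- by rewrite ltn_subLR // h.
- by move: h; rewrite leqNgt (leq_trans h2) // leq_addr.
- by rewrite ltn_subLR // ltnNge h /= subnDA.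
Qed.

Lemma wcat0 x : wcat [::] x = x.
Proof. by apply/funext => n; rewrite /wcat /= subn0. Qed.

Definition wtake n (x : cantor_space) : word := mkseq x n.
Definition wdrop n (x : cantor_space) : cantor_space := fun k => x (n + k)%N.

Lemma size_wtake n x : size (wtake n x) = n. Proof. exact: size_mkseq. Qed.

Lemma wcat_take_drop n x : wcat (wtake n x) (wdrop n x) = x.
Proof.
apply/funext => k; rewrite /wcat size_wtake; case: ltnP => h.
  by rewrite nth_mkseq.
by rewrite /wdrop subnKC.
Qed.

Lemma wtake_wcat a x : wtake (size a) (wcat a x) = a.
Proof.
apply: (@eq_from_nth _ false) => [|i]; rewrite size_wtake // => h.
by rewrite nth_mkseq // /wcat h.
Qed.

Lemma wdrop_wcat a x : wdrop (size a) (wcat a x) = x.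
Proof.
by apply/funext => k; rewrite /wdrop /wcat ltnNge leq_addr /= addKn.
Qed.

Lemma wcat_inj a b x y : size a = size b -> wcat a x = wcat b y ->
  a = b /\ x = y.
Proof.
move=> sz e; split.
  by rewrite -(wtake_wcat a x) e sz wtake_wcat.
by rewrite -(wdrop_wcat a x) e sz wdrop_wcat.
Qed.

Lemma coneE a x : cone a x <-> wtake (size a) x = a.
Proof.
split=> [[y _ <-]|h]; first exact: wtake_wcat.
by exists (wdrop (size a) x) => //; rewrite -{1}h wcat_take_drop.
Qed.

Lemma wtakeD m n x : wtake (m + n) x = wtake m x ++ wtake n (wdrop m x).
Proof.
apply: (@eq_from_nth _ false) => [|i]; first by rewrite size_cat !size_wtake.
rewrite size_wtake => h; rewrite nth_mkseq // nth_cat size_wtake.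
case: ltnP => h2; first by rewrite nth_mkseq.
rewrite nth_mkseq; first by rewrite /wdrop subnKC.
by rewrite ltn_subLR.
Qed.

Definition w0 : cantor_space := fun=> false.

Lemma cone_wcat a u x : (size a <= size u)%N -> cone a (wcat u x) ->
  exists w, u = a ++ w.
Proof.
move=> le /coneE e; exists (drop (size a) u).
rewrite -{1}e -{1}(wtake_wcat u x) -{1}(subnKC le) wtakeD; congr (_ ++ _).
apply: (@eq_from_nth _ false) => [|i]; rewrite size_wtake ?size_drop // => h.
by rewrite nth_mkseq // /wdrop /wcat -ltn_subRL h nth_drop.
Qed.

Lemma cone_cat a w x : cone a (wcat (a ++ w) x).
Proof. by rewrite wcat_cat; exists (wcat w x). Qed.

Lemma cone_self a x : cone a (wcat a x).
Proof. by exists x. Qed.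

Section Partitions.
Variables (T : choiceType) (p : T -> word).
Implicit Type s : {fset T}.

Lemma cone_partitionP s : cone_partition p s <->
  (forall x, exists2 t, t \in s & cone (p t) x) /\
  (forall x t t', t \in s -> t' \in s -> cone (p t) x -> cone (p t') x ->
     t = t').
Proof.
split=> [[tr cov]|[cov tr]]; split.
- by move=> x; have : [set: cantor_space] x by []; rewrite -cov => -[t ts tx]; exists t.
- by move=> x t t' ts t's tx t'x; apply: tr => //; exists x.
- by move=> t t' ts t's [x [tx t'x]]; exact: (tr x).
- by apply/seteqP; split => // x _; have [t ts tx] := cov x; exists t.
Qed.

Lemma part_prefix s t t' u w w' : cone_partition p s -> t \in s -> t' \in s ->
  u = p t ++ w -> u = p t' ++ w' -> t = t' /\ w = w'.
Proof.
move=> /cone_partitionP [_ tr] ts t's e e'.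
have tt : t = t'.
  apply: (tr (wcat u w0)) => //; first by rewrite e; exact: cone_cat.
  by rewrite e'; exact: cone_cat.
split=> //; subst t'; move: e'; rewrite e => /eqP.
by rewrite eqseq_cat // eqxx /= => /eqP.
Qed.

Definition maxlen s := (\max_(t <- s) size (p t))%N.

Lemma maxlenP s t : t \in s -> (size (p t) <= maxlen s)%N.
Proof. by move=> ts; rewrite /maxlen; apply: leq_bigmax_seq. Qed.

Lemma part_total s u : cone_partition p s -> (maxlen s <= size u)%N ->
  exists t w, t \in s /\ u = p t ++ w.
Proof.
move=> /cone_partitionP [cov _] le; have [t ts tu] := cov (wcat u w0).
have [|w e] := cone_wcat _ tu; first exact: leq_trans (maxlenP ts) le.
by exists t, w.
Qed.

(* Splitting one cone into its two halves preserves partitions. *)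
Lemma part_split s t t0 t1 : cone_partition p s -> t \in s ->
  p t0 = p t ++ [:: false] -> p t1 = p t ++ [:: true] ->
  cone_partition p (t0 |` (t1 |` (s `\ t)))%fset.
Proof.
move=> /cone_partitionP [cov tr] ts e0 e1; apply/cone_partitionP.
have cs (b : bool) x : cone (p t ++ [:: b]) x -> cone (p t) x.
  by move=> [y _ <-]; exact: cone_cat.
have cb (b b' : bool) x :
    cone (p t ++ [:: b]) x -> cone (p t ++ [:: b']) x -> b = b'.
  move=> /coneE + /coneE; rewrite !size_cat /= => -> /eqP.
  by rewrite eqseq_cat // eqxx /= => /eqP [].
split.
- move=> x; have [t' t's t'x] := cov x.
  have [tt|tt] := eqVneq t' t; last first.
    by exists t' => //; rewrite !inE tt t's !orbT.
  subst t'; case: t'x => y _ <-.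
  have -> : y = wcat [:: y 0%N] (wdrop 1 y) by rewrite -[LHS](wcat_take_drop 1).
  rewrite -wcat_cat; case: (y 0%N).
    by exists t1; [rewrite !inE eqxx orbT|rewrite e1; exact: cone_self].
  by exists t0; [rewrite !inE eqxx|rewrite e0; exact: cone_self].
- move=> x u v; rewrite !inE.
  move=> /or3P[/eqP ->|/eqP ->|/andP[nu us]] /or3P[/eqP ->|/eqP ->|/andP[nv vs]];
    rewrite ?e0 ?e1 => ux vx //.
  + by have := cb _ _ _ ux vx.
  + by case/eqP: nv; apply: (tr x) => //; exact: cs ux.
  + by have := cb _ _ _ ux vx.
  + by case/eqP: nv; apply: (tr x) => //; exact: cs ux.
  + by case/eqP: nu; apply: (tr x) => //; exact: cs vx.
  + by case/eqP: nu; apply: (tr x) => //; exact: cs vx.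
  + exact: (tr x).
Qed.

End Partitions.

Definition is_thompson (f : homeo cantor_space) : Prop :=
  exists s : {fset word * word},
    [/\ cone_partition fst s, cone_partition snd s
      & forall t, t \in s -> forall x, f (wcat t.1 x) = wcat t.2 x].

Lemma is_thompsonP f : is_thompson f <->
  exists n, forall u, size u = n ->
    exists v, forall x, f (wcat u x) = wcat v x.
Proof.
split=> [[s [ps1 ps2 fs]]|[n fn]].
  exists (maxlen fst s) => u su.
  have [|[a b] [w [ts ->]]] := part_total (u := u) ps1; first by rewrite su.
  by exists (b ++ w) => x; rewrite /= !wcat_cat (fs _ ts).
have {}fn (u : n.-tuple bool) : {v | forall x, f (wcat u x) = wcat v x}.
  by apply: cid; apply: fn; rewrite size_tuple.
pose F u := (tval u, sval (fn u)).
exists [fset F u | u : n.-tuple bool]%fset; split.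
- apply/cone_partitionP; split=> [x|x _ _ /imfsetP[u _ ->] /imfsetP[v _ ->]].
    have sz : size (wtake n x) == n by rewrite size_wtake.
    exists (F (Tuple sz)); first exact: in_imfset.
    by exists (wdrop n x) => //=; exact: wcat_take_drop.
  move=> /coneE /= + /coneE /=; rewrite !size_tuple => -> e.
  by congr F; exact: val_inj.
- apply/cone_partitionP; split=> [x|x _ _ /imfsetP[u _ ->] /imfsetP[v _ ->]].
    pose y := homeo_inv f x.
    have sz : size (wtake n y) == n by rewrite size_wtake.
    exists (F (Tuple sz)); first exact: in_imfset.
    exists (wdrop n y) => //=; case: (fn _) => v /= <-.
    by rewrite wcat_take_drop homeoVK.
  rewrite /F /=; have hu := svalP (fn u); have hv := svalP (fn v).
  move=> [y _ <-] [z _]; rewrite -hu -hv => /(can_inj (@homeoK _ f)).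
  by move=> /wcat_inj [|/val_inj -> _]; first by rewrite !size_tuple.
- by move=> _ /imfsetP[u _ ->] x /=; case: (fn u).
Qed.

Lemma is_thompson1 : is_thompson (1%g : homeo cantor_space).
Proof. by apply/is_thompsonP; exists 0%N => u _; exists u. Qed.

Lemma is_thompsonM (f g : homeo cantor_space) :
  is_thompson f -> is_thompson g -> is_thompson (f * g)%g.
Proof.
move=> /is_thompsonP[m fm] /is_thompsonP[n gn]; apply/is_thompsonP.
exists (m + n)%N => u su.
have [|v fv] := fm (take m u); first by rewrite size_takel // su leq_addr.
pose v' := v ++ drop m u.
have sv' : (n <= size v')%N by rewrite size_cat size_drop su addKn leq_addl.
have [|w gw] := gn (take n v'); first by rewrite size_takel.
exists (w ++ drop n v') => x; rewrite wcat_cat -gw -wcat_cat cat_take_drop.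
by rewrite wcat_cat -fv -wcat_cat cat_take_drop.
Qed.

Lemma is_thompsonV (f : homeo cantor_space) :
  is_thompson f -> is_thompson (f^-1)%g.
Proof.
move=> [s [ps1 ps2 fs]].
have fs' (t : word * word) : t \in s -> forall x,
    (f^-1)%g (wcat t.2 x) = wcat t.1 x.
  by move=> ts x; rewrite -fs //; exact: homeoK.
apply/is_thompsonP; exists (maxlen snd s) => u su.
have [|t [w [ts ->]]] := part_total (u := u) ps2; first by rewrite su.
by exists (t.1 ++ w) => x; rewrite !wcat_cat (fs' _ ts).
Qed.

Definition thompson_pred : {pred homeo cantor_space} :=
  fun f => `[< is_thompson f >].

Lemma thompson_group_closed : group_closed thompson_pred.
Proof.
split=> [|f g /asboolP fV /asboolP gV]; apply/asboolP.
  exact: is_thompson1.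
by apply: is_thompsonM => //; exact: is_thompsonV.
Qed.

Definition thompsonV := {f : homeo cantor_space | thompson_pred f}.
HB.instance Definition _ := SubChoice.on thompsonV.
HB.instance Definition _ :=
  SubChoice_isSubGroup.Build _ thompson_pred thompsonV thompson_group_closed.

Section VHtheta.
Variables (H : groupType) (theta : {multiplicative H -> H}).

(* The triplet [(a, b, h)] is the pair [((a, b), h)]. *)
Definition triplet := (word * word * H)%type.
Definition src (t : triplet) : word := t.1.1.
Definition tgt (t : triplet) : word := t.1.2.
Definition lab (t : triplet) : H := t.2.

Record table := Table {
  triplets :> {fset triplet};
  src_partition : cone_partition src triplets;
  tgt_partition : cone_partition tgt triplets }.

HB.instance Definition _ := gen_eqMixin table.
HB.instance Definition _ := gen_choiceMixin table.

Definition table_split (s s' : table) : Prop :=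
  exists a b h, (a, b, h) \in triplets s /\
    triplets s' = ((a ++ [:: false], b ++ [:: false], h) |`
      ((a ++ [:: true], b ++ [:: true], theta h) |`
        (triplets s `\ (a, b, h))))%fset.

Definition table_equiv : table -> table -> Prop :=
  clos_refl_sym_trans table table_split.

Lemma table_equiv_sym s s' : table_equiv s s' -> table_equiv s' s.
Proof. exact: rst_sym. Qed.

Lemma table_equiv_trans s s' s'' :
  table_equiv s s' -> table_equiv s' s'' -> table_equiv s s''.
Proof. exact: rst_trans. Qed.

Definition table_eqv (s s' : table) : bool := `[< table_equiv s s' >].

Lemma table_eqv_is_equiv : equiv_class_of table_eqv.
Proof.
split=> [s|s s'|s s' s''].
- by apply/asboolP; exact: rst_refl.
- by apply/asboolP/asboolP => ?; exact: rst_sym.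
- by move=> /asboolP e /asboolP e'; apply/asboolP; exact: rst_trans e e'.
Qed.

Canonical table_equiv_rel := EquivRelPack table_eqv_is_equiv.

Definition VH := {eq_quot table_equiv_rel}%qT.
HB.instance Definition _ := Choice.on VH.
HB.instance Definition _ := EqQuotient.on VH.

(* [s1] and [s2] have the form [{(a_i, b_i, h_i)}] and [{(b_i, d_i, k_i)}]. *)
Definition composable (s1 s2 : table) :=
  forall b, (exists2 t, t \in triplets s1 & tgt t = b) <->
            (exists2 t, t \in triplets s2 & src t = b).

(* [s = {(a_i, d_i, h_i k_i)}]. *)
Definition table_prod (s1 s2 s : table) : Prop :=
  composable s1 s2 /\
  forall a d g, (a, d, g) \in triplets s <->
    exists b h k, [/\ (a, b, h) \in triplets s1,
      (b, d, k) \in triplets s2 & g = (h * k)%g].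

Lemma tableP (s s' : table) : triplets s =i triplets s' -> s = s'.
Proof.
case: s s' => [s p q] [s' p' q'] /= /fsetP e; subst s'.
by congr Table; exact: Prop_irrelevance.
Qed.

Definition thetan n (h : H) : H := iter n theta h.

Lemma thetanM n h k : thetan n (h * k)%g = (thetan n h * thetan n k)%g.
Proof. by elim: n => //= n ->; rewrite gmulfM. Qed.

Lemma thetan1 n : thetan n 1%g = 1%g.
Proof.
have h1 := thetanM n 1%g 1%g; rewrite mulg1 in h1.
by rewrite -(mulKg (thetan n 1%g) (thetan n 1%g)) -h1 mulVg.
Qed.

Lemma thetanD m n h : thetan (m + n) h = thetan m (thetan n h).
Proof. by rewrite /thetan iterD. Qed.

Lemma thetan_true w h :
  thetan (count id (true :: w)) h = thetan (count id w) (theta h).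
Proof. exact: iterSr. Qed.

(* [(u, v, g)] is obtained from a triplet of [s] by repeated splitting. *)
Definition table_ev (s : table) (u v : word) (g : H) : Prop :=
  exists t w, [/\ t \in triplets s, u = src t ++ w, v = tgt t ++ w
    & g = thetan (count id w) (lab t)].

Definition ev_equiv (P Q : word -> word -> H -> Prop) :=
  exists n, forall u, (n <= size u)%N -> forall v g, P u v g <-> Q u v g.

Lemma ev_refl P : ev_equiv P P. Proof. by exists 0%N. Qed.
Lemma ev_sym P Q : ev_equiv P Q -> ev_equiv Q P.
Proof. by move=> [n h]; exists n => u nu v g; split=> /(h u nu). Qed.
Lemma ev_trans P Q R : ev_equiv P Q -> ev_equiv Q R -> ev_equiv P R.
Proof.
move=> [m h] [n k]; exists (maxn m n) => u; rewrite geq_max => /andP[mu nu] v g.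
by split=> [/(h _ mu)/(k _ nu)|/(k _ nu)/(h _ mu)].
Qed.

Lemma split_ev s s' : table_split s s' -> ev_equiv (table_ev s) (table_ev s').
Proof.
move=> [a [b [h [abs e]]]]; exists (size a).+1 => u su v g.
split=> [[t [w [ts eu ev eg]]]|[t [w []]]].
- have [ta|ta] := eqVneq t (a, b, h); last first.
    by exists t, w; split => //; rewrite e !inE ta ts !orbT.
  subst t; case: w eu ev eg => [|[] w] eu ev eg.
  + by move: su; rewrite eu cats0 /src /= ltnn.
  + exists (a ++ [:: true], b ++ [:: true], theta h), w; split.
    * by rewrite e !inE eqxx !orbT.
    * by rewrite eu /src /= -catA.
    * by rewrite ev /tgt /= -catA.
    * by rewrite eg thetan_true.
  + exists (a ++ [:: false], b ++ [:: false], h), w; split.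
    * by rewrite e !inE eqxx.
    * by rewrite eu /src /= -catA.
    * by rewrite ev /tgt /= -catA.
    * by rewrite eg.
- rewrite e !inE => /or3P[/eqP ->|/eqP ->|/andP[_ ts]] eu ev eg.
  + by exists (a, b, h), (false :: w); split; rewrite ?eu ?ev ?eg // -catA.
  + exists (a, b, h), (true :: w); split; rewrite ?eu ?ev ?eg // -?catA //.
    by rewrite thetan_true.
  + by exists t, w.
Qed.

Lemma equiv_ev s s' : table_equiv s s' -> ev_equiv (table_ev s) (table_ev s').
Proof.
elim=> [x y|x|x y _|x y z _ h _ k].
- exact: split_ev.
- exact: ev_refl.
- exact: ev_sym.
- exact: ev_trans h k.
Qed.

Lemma split_exists (s : table) t : t \in triplets s ->
  exists2 s', table_split s s' &
    triplets s' = ((src t ++ [:: false], tgt t ++ [:: false], lab t) |`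
      ((src t ++ [:: true], tgt t ++ [:: true], theta (lab t)) |`
        (triplets s `\ t)))%fset.
Proof.
case: t => [[a b] h] ts.
have P := part_split (src_partition s) ts
  (t0 := (a ++ [:: false], b ++ [:: false], h))
  (t1 := (a ++ [:: true], b ++ [:: true], theta h)) erefl erefl.
have Q := part_split (tgt_partition s) ts
  (t0 := (a ++ [:: false], b ++ [:: false], h))
  (t1 := (a ++ [:: true], b ++ [:: true], theta h)) erefl erefl.
by exists (Table P Q) => //; exists a, b, h.
Qed.

(* Splitting until all sources (resp. targets) have the same length. *)
Lemma equalize (p : triplet -> word) (s : table) n :
  p = src \/ p = tgt -> (forall t, t \in triplets s -> size (p t) <= n)%N ->
  exists2 s', table_equiv s s' & forall t, t \in triplets s' -> size (p t) = n.
Proof.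
move=> pE; pose f t := (2 ^ (n - size (p t))).-1%N.
have fsum (A : {fset triplet}) t :
    (\sum_(i <- (t |` A)%fset) f i <= f t + \sum_(i <- A) f i)%N.
  have [tA|tA] := boolP (t \in A); last by rewrite big_fsetU1.
  have -> : (t |` A)%fset = A by apply/fsetP => x; rewrite !inE; case: eqP => // ->.
  exact: leq_addl.
have [m] := ubnP (\sum_(i <- triplets s) f i)%N.
elim: m s => // m IH s; rewrite ltnS => le sn.
have [all|] := boolP (all (fun t => size (p t) == n) (triplets s)).
  by exists s; [exact: rst_refl|move=> t ts; apply/eqP; apply: (allP all)].
move=> /allPn[t ts tn].
have tn' : (size (p t) < n)%N by rewrite ltn_neqAle tn sn.
have [s' ss' es'] := split_exists ts.
have [s'' s's'' h] : exists2 s'', table_equiv s' s'' &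
    forall t, t \in triplets s'' -> size (p t) = n.
  apply: IH.
  - apply: leq_trans le; rewrite es' (big_fsetD1 t ts) /=.
    apply: leq_ltn_trans (fsum _ _) _.
    apply: leq_ltn_trans (leq_add (leqnn _) (fsum _ _)) _.
    rewrite addnA ltn_add2r /f.
    have -> : size (p (src t ++ [:: false], tgt t ++ [:: false], lab t)) = (size (p t)).+1.
      by case: pE => ->; rewrite size_cat addn1.
    have -> : size (p (src t ++ [:: true], tgt t ++ [:: true], theta (lab t))) = (size (p t)).+1.
      by case: pE => ->; rewrite size_cat addn1.
    rewrite -(subnSK tn') expnS mul2n -addnn.
    case: (2 ^ _)%N (expn_gt0 2 (n - (size (p t)).+1)) => //= k _.
    by rewrite addnS.
  - move=> x; rewrite es' !inE => /or3P[/eqP ->|/eqP ->|/andP[_ /sn //]];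
    by case: pE tn' => ->; rewrite size_cat addn1.
by exists s'' => //; apply: rst_trans s's''; exact: rst_step.
Qed.

Lemma ev_equiv_table s s' :
  ev_equiv (table_ev s) (table_ev s') -> table_equiv s s'.
Proof.
move=> e0.
pose n0 := maxn (maxlen src (triplets s)) (maxlen src (triplets s')).
have key N : (n0 <= N)%N -> exists s1 s2, [/\ table_equiv s s1,
    table_equiv s' s2, forall t, t \in triplets s1 -> size (src t) = N
    & forall t, t \in triplets s2 -> size (src t) = N].
  rewrite geq_max => /andP[l1 l2].
  have [|s1 ss1 h1] := @equalize src s N (or_introl erefl).
    by move=> t ts; apply: leq_trans l1; exact: maxlenP.
  have [|s2 ss2 h2] := @equalize src s' N (or_introl erefl).
    by move=> t ts; apply: leq_trans l2; exact: maxlenP.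
  by exists s1, s2.
have [s1 [s2 [q1 q2 h1 h2]]] := key _ (leqnn _).
have e12 := ev_trans (ev_trans (ev_sym (equiv_ev q1)) e0) (equiv_ev q2).
suff half r r' : (forall t, t \in triplets r -> size (src t) = n0) ->
    (forall t, t \in triplets r' -> size (src t) = n0) ->
    ev_equiv (table_ev r) (table_ev r') ->
    forall t, t \in triplets r -> t \in triplets r'.
  apply: (table_equiv_trans q1); apply: table_equiv_trans (table_equiv_sym q2).
  have -> : s1 = s2; last exact: rst_refl.
  apply: tableP => t; apply/idP/idP; first exact: half.
  by apply: half => //; exact: ev_sym.
move=> hr hr' [n ne] [[a b] h] ts.
pose z := nseq n false.
have cz : count id z = 0%N by rewrite /z count_nseq mul0n.
have [|+ _] := ne (a ++ z) _ (b ++ z) h; first by rewrite size_cat size_nseq leq_addl.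
case; first by exists (a, b, h), z; rewrite cz; split.
move=> [[a' b'] h'] [w [t's]]; rewrite /src /tgt /lab /=.
have sa : size a = size a' by have := hr _ ts; have := hr' _ t's; rewrite /src /= => -> ->.
move=> /eqP; rewrite eqseq_cat //= => /andP[/eqP ea /eqP ew]; subst a' w.
move=> eb; have sb : size b = size b'.
  by move: (congr1 size eb); rewrite !size_cat => /addIn.
move: eb => /eqP; rewrite eqseq_cat // => /andP[/eqP eb _]; subst b'.
by rewrite cz /= => ->.
Qed.

Definition ev_comp (P Q : word -> word -> H -> Prop) u v g :=
  exists m h k, [/\ P u m h, Q m v k & g = (h * k)%g].

Lemma prod_ev s1 s2 s : table_prod s1 s2 s ->
  ev_equiv (table_ev s) (ev_comp (table_ev s1) (table_ev s2)).
Proof.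
move=> [bE sE]; exists 0%N => u _ v g; split.
- move=> [[[a d] x] [w [/sE[b [h [k [t1 t2 ->]]]] -> -> ->]]].
  exists (b ++ w), (thetan (count id w) h), (thetan (count id w) k); split.
  + by exists (a, b, h), w.
  + by exists (b, d, k), w.
  + exact: thetanM.
- move=> [m [h [k [[t1 [w1 [t1s eu em eh]]] [t2 [w2 [t2s em' ev ek]]] eg]]]].
  have [t2' t2's e] : exists2 t, t \in triplets s2 & src t = tgt t1.
    by apply/bE; exists t1.
  have em2 : m = src t2' ++ w1 by rewrite e em.
  have [e2 ew] := part_prefix (src_partition s2) t2s t2's em' em2.
  clear em2 t2's; subst t2' w2; move: t1s t2s e eu em eh em' ev ek.
  case: t1 t2 => [[a b] x] [[b' d] y]; rewrite /src /tgt /lab /= => t1s t2s e.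
  subst b' => eu em eh em' ev ek.
  exists (a, d, (x * y)%g), w1; split => //; last by rewrite eg eh ek -thetanM.
  by apply/sE; exists b, x, y.
Qed.

Lemma ev_size s : exists C, forall u v g,
  table_ev s u v g -> (size u <= C + size v)%N.
Proof.
exists (maxlen src (triplets s)) => u v g [t [w [ts -> -> _]]].
rewrite !size_cat addnA leq_add2r; apply: leq_trans (maxlenP _ ts) _.
exact: leq_addr.
Qed.

Lemma ev_comp_equiv s1 s2 P Q :
  ev_equiv P (table_ev s1) -> ev_equiv Q (table_ev s2) ->
  ev_equiv (ev_comp P Q) (ev_comp (table_ev s1) (table_ev s2)).
Proof.
move=> [m hP] [n hQ]; have [C hC] := ev_size s1.
exists (maxn m (C + n)) => u; rewrite geq_max => /andP[mu nu] v g.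
have sz x h : table_ev s1 u x h -> (n <= size x)%N.
  by move=> /hC le; rewrite -(leq_add2l C); exact: leq_trans nu le.
split=> -[x [h [k [p q ->]]]]; exists x, h, k; split => //.
- exact/hP.
- by apply/hQ => //; apply: (sz _ h); exact/hP.
- exact/hP.
- by apply/hQ => //; exact: sz p.
Qed.

Lemma ev_compA P Q R : ev_equiv (ev_comp P (ev_comp Q R)) (ev_comp (ev_comp P Q) R).
Proof.
exists 0%N => u _ v g; split.
- move=> [x [h [k' [p [y [k [l [q r ->]]]] ->]]]].
  by exists y, (h * k)%g, l; split; rewrite ?mulgA //; exists x, h, k.
- move=> [y [h' [l [[x [h [k [p q ->]]]] r ->]]]].
  by exists x, h, (k * l)%g; split; rewrite ?mulgA //; exists y, k, l.
Qed.

Lemma table_prod_equiv s1 s2 s s1' s2' s' :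
  table_equiv s1 s1' -> table_equiv s2 s2' ->
  table_prod s1 s2 s -> table_prod s1' s2' s' -> table_equiv s s'.
Proof.
move=> e1 e2 /prod_ev p /prod_ev p'; apply: ev_equiv_table.
apply: (ev_trans p); apply: ev_trans (ev_sym p').
by apply: ev_comp_equiv; exact: equiv_ev.
Qed.

Lemma part_full (p : triplet -> word) (s : table) n :
  cone_partition p (triplets s) ->
  (forall t, t \in triplets s -> size (p t) = n) ->
  forall b, (exists2 t, t \in triplets s & p t = b) <-> size b = n.
Proof.
move=> /cone_partitionP[cov _] sn b; split=> [[t ts <-]|sb]; first exact: sn.
have [t ts /coneE e] := cov (wcat b w0); exists t => //.
by rewrite -e (sn _ ts) -sb wtake_wcat.
Qed.

Definition prod_fset (s1 s2 : {fset triplet}) : {fset triplet} :=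
  [fset ((src x.1, tgt x.2), (lab x.1 * lab x.2)%g)
     | x in [fset x in (s1 `*` s2)%fset | tgt x.1 == src x.2]%fset]%fset.

Lemma prod_fsetP s1 s2 t : reflect
  (exists t1 t2, [/\ t1 \in s1, t2 \in s2, tgt t1 = src t2
     & t = ((src t1, tgt t2), (lab t1 * lab t2)%g)])
  (t \in prod_fset s1 s2).
Proof.
apply: (iffP idP) => [/imfsetP[[t1 t2] /=]|[t1 [t2 [h1 h2 e ->]]]].
  by rewrite !inE /= => /andP[/andP[h1 h2] /eqP e] ->; exists t1, t2.
by apply/imfsetP; exists (t1, t2) => //=; rewrite !inE /= h1 h2 e eqxx.
Qed.

Lemma part_inj (p : triplet -> word) (s : {fset triplet}) t t' :
  cone_partition p s -> t \in s -> t' \in s -> p t = p t' -> t = t'.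
Proof.
move=> ps ts t's e.
have h : p t ++ [::] = p t' ++ [::] by rewrite e.
by have [] := part_prefix ps ts t's erefl h.
Qed.

Lemma composable_prod s1 s2 : composable s1 s2 -> exists s, table_prod s1 s2 s.
Proof.
move=> c.
have P : cone_partition src (prod_fset s1 s2).
  have /cone_partitionP[cov tr] := src_partition s1.
  apply/cone_partitionP; split=> [x|x t t'].
    have [t1 h1 c1] := cov x.
    have [t2 h2 e] : exists2 t, t \in triplets s2 & src t = tgt t1.
      by apply/c; exists t1.
    exists ((src t1, tgt t2), (lab t1 * lab t2)%g) => //.
    by apply/prod_fsetP; exists t1, t2.
  move=> /prod_fsetP[t1 [t2 [h1 h2 e ->]]] /prod_fsetP[t1' [t2' [h1' h2' e' ->]]].
  rewrite /= => c1 c2; have e1 := tr _ _ _ h1 h1' c1 c2; subst t1'.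
  have e2 := part_inj (src_partition s2) h2 h2' (etrans (esym e) e').
  by subst t2'.
have Q : cone_partition tgt (prod_fset s1 s2).
  have /cone_partitionP[cov tr] := tgt_partition s2.
  apply/cone_partitionP; split=> [x|x t t'].
    have [t2 h2 c2] := cov x.
    have [t1 h1 e] : exists2 t, t \in triplets s1 & tgt t = src t2.
      by apply/c; exists t2.
    exists ((src t1, tgt t2), (lab t1 * lab t2)%g) => //.
    by apply/prod_fsetP; exists t1, t2.
  move=> /prod_fsetP[t1 [t2 [h1 h2 e ->]]] /prod_fsetP[t1' [t2' [h1' h2' e' ->]]].
  rewrite /= => c1 c2; have e2 := tr _ _ _ h2 h2' c1 c2; subst t2'.
  have e1 := part_inj (tgt_partition s1) h1 h1' (etrans e (esym e')).
  by subst t1'.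
exists (Table P Q); split=> // a d g; split.
- move=> /prod_fsetP[[[a' b] h] [[[b' d'] k] []]]; rewrite /src /tgt /lab /=.
  by move=> h1 h2 e [-> -> ->]; subst b'; exists b, h, k.
- move=> [b [h [k [h1 h2 ->]]]]; apply/prod_fsetP.
  by exists (a, b, h), (b, d, k).
Qed.

Lemma composable_exists s1 s2 : exists s1' s2',
  [/\ table_equiv s1 s1', table_equiv s2 s2' & composable s1' s2'].
Proof.
pose n := maxn (maxlen tgt (triplets s1)) (maxlen src (triplets s2)).
have [|s1' e1 h1] := @equalize tgt s1 n (or_intror erefl).
  by move=> t ts; apply: leq_trans (leq_maxl _ _); exact: maxlenP.
have [|s2' e2 h2] := @equalize src s2 n (or_introl erefl).
  by move=> t ts; apply: leq_trans (leq_maxr _ _); exact: maxlenP.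
exists s1', s2'; split=> // b.
rewrite (part_full (tgt_partition s1') h1).
by rewrite (part_full (src_partition s2') h2).
Qed.

Lemma one_partition (p : triplet -> word) (t : triplet) :
  p t = [::] -> cone_partition p [fset t]%fset.
Proof.
move=> e; apply/cone_partitionP; split=> [x|x u v].
  by exists t; [rewrite inE|rewrite e; exists x; rewrite ?wcat0].
by rewrite !inE => /eqP -> /eqP ->.
Qed.

Definition table1 : table :=
  @Table [fset ([::], [::], 1%g)]%fset
    (@one_partition src ([::], [::], 1%g) erefl)
    (@one_partition tgt ([::], [::], 1%g) erefl).

Definition tripletV (t : triplet) : triplet := ((tgt t, src t), (lab t)^-1%g).

Lemma tripletVK : involutive tripletV.
Proof. by case=> [[a b] h]; rewrite /tripletV /tgt /src /lab /= invgK. Qed.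

Lemma partitionV (p q : triplet -> word) (s : {fset triplet}) :
  (forall t, q (tripletV t) = p t) ->
  cone_partition p s -> cone_partition q (tripletV @` s)%fset.
Proof.
move=> e /cone_partitionP[cov tr]; apply/cone_partitionP; split=> [x|x u v].
  have [t ts tx] := cov x; exists (tripletV t); last by rewrite e.
  exact: in_imfset.
move=> /imfsetP[t /= ts ->] /imfsetP[t' /= ts' ->]; rewrite !e => c c'.
by rewrite (tr _ _ _ ts ts' c c').
Qed.

Definition tableV (s : table) : table :=
  @Table (tripletV @` triplets s)%fset
    (@partitionV tgt src _ (fun=> erefl) (tgt_partition s))
    (@partitionV src tgt _ (fun=> erefl) (src_partition s)).

Lemma mem_tableV s a b h :
  ((a, b, h) \in triplets (tableV s)) = ((b, a, h^-1%g) \in triplets s).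
Proof.
apply/imfsetP/idP => [[[[b' a'] h'] /= hs [-> -> ->]]|hs].
  by rewrite invgK.
by exists (b, a, h^-1%g) => //; rewrite /tripletV /tgt /src /lab /= invgK.
Qed.

Lemma tableVK s : tableV (tableV s) = s.
Proof. by apply: tableP => -[[a b] h]; rewrite !mem_tableV invgK. Qed.

Lemma ev_table1 u v g : table_ev table1 u v g <-> v = u /\ g = 1%g.
Proof.
split=> [[t [w []]]|[-> ->]].
  by rewrite inE => /eqP -> -> -> ->; rewrite thetan1.
by exists ([::], [::], 1%g), u; rewrite inE eqxx thetan1.
Qed.

Lemma ev_VM s :
  ev_equiv (ev_comp (table_ev (tableV s)) (table_ev s)) (table_ev table1).
Proof.
exists (maxlen tgt (triplets s)) => u su v g; rewrite ev_table1; split.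
- move=> [m [h [k [[[[b a] x] [w [t1 eu em eh]]] [[[a' b'] y] [w' [t2 em' ev ek]]] ->]]]].
  rewrite mem_tableV in t1; move: eu em eh em' ev ek.
  rewrite /src /tgt /lab /= => eu em eh em' ev ek.
  have [[ea eb ex] ew] := part_prefix (src_partition s) t1 t2 em em'.
  by subst; split => //; rewrite -thetanM mulgV thetan1.
- move=> [-> ->]; have [t [w [ts ->]]] := part_total (tgt_partition s) su.
  case: t ts => [[a b] h] ts; rewrite /tgt /=.
  exists (a ++ w), (thetan (count id w) h^-1)%g, (thetan (count id w) h); split.
  + by exists (b, a, h^-1)%g, w; split; rewrite ?mem_tableV ?invgK.
  + by exists (a, b, h), w.
  + by rewrite -thetanM mulVg thetan1.
Qed.

Lemma ev_1l P : ev_equiv (ev_comp (table_ev table1) P) P.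
Proof.
exists 0%N => u _ v g; split.
  by move=> [m [h [k [/ev_table1[-> ->] p ->]]]]; rewrite mul1g.
by move=> p; exists u, 1%g, g; rewrite mul1g; split => //; exact/ev_table1.
Qed.

Lemma ev_1r P : ev_equiv (ev_comp P (table_ev table1)) P.
Proof.
exists 0%N => u _ v g; split.
  by move=> [m [h [k [p /ev_table1[-> ->] ->]]]]; rewrite mulg1.
by move=> p; exists v, g, 1%g; rewrite mulg1; split => //; exact/ev_table1.
Qed.

Definition vh_pi (s : table) : VH := \pi_VH%qT s.

Lemma vh_piP s s' : vh_pi s = vh_pi s' <-> table_equiv s s'.
Proof.
split=> [/eqquotP /asboolP //|e]; apply/eqquotP; exact/asboolP.
Qed.

Lemma vh_repr q : vh_pi (repr q) = q.
Proof. exact: reprK. Qed.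

Definition vh1 : VH := vh_pi table1.

(* The class of the product of any composable representatives: these exist by
   [composable_exists] and [composable_prod], and the choice is irrelevant by
   [vhM_pi]. *)
Definition vhM (q1 q2 : VH) : VH :=
  xget vh1 [set q | exists s1 s2 s, [/\ vh_pi s1 = q1, vh_pi s2 = q2,
    table_prod s1 s2 s & vh_pi s = q]].

Definition vhV (q : VH) : VH := vh_pi (tableV (repr q)).

Lemma vhM_pi s1 s2 s : table_prod s1 s2 s ->
  vhM (vh_pi s1) (vh_pi s2) = vh_pi s.
Proof.
move=> p; rewrite /vhM; case: xgetP => [q _|/(_ (vh_pi s))].
  move=> [s1' [s2' [s' [/vh_piP e1 /vh_piP e2 p' <-]]]].
  by apply/vh_piP; exact: table_prod_equiv e1 e2 p' p.
by case; exists s1, s2, s.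
Qed.

Definition vh_ev (q : VH) := table_ev (repr q).

Lemma vh_ev_pi s : ev_equiv (vh_ev (vh_pi s)) (table_ev s).
Proof. by apply: equiv_ev; apply/vh_piP; rewrite vh_repr. Qed.

Lemma vh_evM q1 q2 : ev_equiv (vh_ev (vhM q1 q2)) (ev_comp (vh_ev q1) (vh_ev q2)).
Proof.
have [s1 [s2 [e1 e2 /composable_prod[s p]]]] := composable_exists (repr q1) (repr q2).
have -> : vhM q1 q2 = vh_pi s.
  by rewrite -(vhM_pi p); congr vhM; rewrite -[LHS]vh_repr; exact/vh_piP.
apply: ev_trans (vh_ev_pi s) _; apply: ev_trans (prod_ev p) _.
by apply: ev_comp_equiv; apply: equiv_ev; exact: table_equiv_sym.
Qed.

Lemma vh_ev_inj q q' : ev_equiv (vh_ev q) (vh_ev q') -> q = q'.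
Proof.
by move=> /ev_equiv_table /vh_piP; rewrite !vh_repr.
Qed.

Lemma vhMA : associative vhM.
Proof.
move=> x y z; apply: vh_ev_inj.
apply: (ev_trans (vh_evM _ _)); apply: ev_trans _ (ev_sym (vh_evM _ _)).
have l := ev_comp_equiv (ev_refl (vh_ev x)) (ev_sym (vh_evM y z)).
have r := ev_comp_equiv (ev_sym (vh_evM x y)) (ev_refl (vh_ev z)).
exact: ev_trans (ev_sym l) (ev_trans (ev_compA _ _ _) r).
Qed.

Lemma vh1M : left_id vh1 vhM.
Proof.
move=> x; apply: vh_ev_inj; apply: (ev_trans (vh_evM _ _)).
apply: ev_trans (ev_1l _).
exact: ev_sym (ev_comp_equiv (ev_sym (vh_ev_pi table1)) (ev_refl _)).
Qed.

Lemma vhM1 : right_id vh1 vhM.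
Proof.
move=> x; apply: vh_ev_inj; apply: (ev_trans (vh_evM _ _)).
apply: ev_trans (ev_1r _).
exact: ev_sym (ev_comp_equiv (ev_refl _) (ev_sym (vh_ev_pi table1))).
Qed.

Lemma vhVM : left_inverse vh1 vhV vhM.
Proof.
move=> x; apply: vh_ev_inj; apply: (ev_trans (vh_evM _ _)).
apply: ev_trans (ev_sym (vh_ev_pi table1)).
apply: ev_trans (ev_VM (repr x)).
exact: ev_sym (ev_comp_equiv (ev_sym (vh_ev_pi _)) (ev_refl _)).
Qed.

Lemma vhMV : right_inverse vh1 vhV vhM.
Proof.
move=> x; apply: vh_ev_inj; apply: (ev_trans (vh_evM _ _)).
apply: ev_trans (ev_sym (vh_ev_pi table1)).
have := ev_VM (tableV (repr x)); rewrite tableVK; apply: ev_trans.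
exact: ev_sym (ev_comp_equiv (ev_refl _) (ev_sym (vh_ev_pi _))).
Qed.

HB.instance Definition _ := isGroup.Build VH vhMA vh1M vhM1 vhVM vhMV.

End VHtheta.

Local Open Scope ring_scope.

HB.mixin Record Metric_isUltrametric (K : numDomainType) M & Metric K M := {
  mdist_ultra : forall x y z : M,
    mdist x z <= Num.max (mdist x y) (mdist y z) }.

#[short(type="ultrametricType")]
HB.structure Definition Ultrametric (K : numDomainType) :=
  { M of Metric K M & Metric_isUltrametric K M }.

Section FSS.
Variables (R : realType) (X : ultrametricType R).

Record openBall := OpenBall {
  ball_set :> set X;
  ball_setP : exists x r, 0 < r /\ ball_set = ball x r }.

Lemma openBall_inj : injective ball_set.
Proof.
by move=> [A hA] [B hB] /= e; subst B; congr OpenBall; exact: Prop_irrelevance.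
Qed.

Definition similarity (A B : set X) (h : A -> B) : Prop :=
  exists2 lambda : R, 0 < lambda & forall x y : A,
    mdist (val (h x)) (val (h y)) = lambda * mdist (val x) (val y).

Record finSimStruct := FinSimStruct {
  Sim : forall B1 B2 : openBall, set (B1 -> B2);
  Sim_finite : forall B1 B2, finite_set (@Sim B1 B2);
  Sim_similarity : forall (B1 B2 : openBall) (h : B1 -> B2),
    Sim h -> similarity h;
  Sim_surj : forall (B1 B2 : openBall) (h : B1 -> B2),
    Sim h -> range h = [set: B2];
  Sim_id : forall B, @Sim B B id;
  Sim_comp : forall (B1 B2 B3 : openBall) (h : B1 -> B2) (k : B2 -> B3),
    Sim h -> Sim k -> Sim (k \o h);
  Sim_inv : forall (B1 B2 : openBall) (h : B1 -> B2), Sim h ->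
    exists2 k : B2 -> B1, Sim k & cancel h k /\ cancel k h;
  (* [B4] is the image of [B3] under [h], and [k] the restriction of [h]. *)
  Sim_restr : forall (B1 B2 B3 : openBall) (h : B1 -> B2), Sim h ->
    B3 `<=` B1 ->
    exists (B4 : openBall) (k : B3 -> B4),
      [/\ (B4 : set X) = [set val (h x) | x in [set x : B1 | ball_set B3 (val x)]],
          forall (x : B1) (y : B3), val x = val y -> val (k y) = val (h x)
        & Sim k] }.

Variable S : finSimStruct.

Definition sim_class (B : openBall) : set openBall :=
  [set B' | @Sim S B B' !=set0].

Definition finitely_many_classes : Prop := finite_set (range sim_class).

Definition is_fss (f : homeo X) : Prop :=
  forall x, exists (B B' : openBall) (k : B -> B'),
    [/\ ball_set B x, f @` B = B', forall y : B, val (k y) = f (val y) & Sim S k].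

Definition el (A : set X) x (Ax : A x) : A := SigSub (mem_set Ax).

Lemma fss_image (f : homeo X) (B B' : openBall) (k : B -> B') :
  Sim S k -> (forall y : B, val (k y) = f (val y)) -> f @` B = B'.
Proof.
move=> Sk kf; apply/seteqP; split=> [_ [x Bx <-]|y By].
  by have <- := kf (el Bx); exact: set_valP.
have : [set: B'] (el By) by [].
rewrite -(Sim_surj Sk) => -[x _ e]; exists (val x); first exact: set_valP.
by rewrite -kf e.
Qed.

Lemma ball_nested (x z : X) r s : r <= s -> forall y, ball x r y -> ball z s y ->
  ball x r `<=` ball z s.
Proof.
move=> rs y; rewrite !ballEmdist /= => xy zy w /= xw.
have yw : mdist y w < r.
  by apply: le_lt_trans (mdist_ultra y x w) _; rewrite gt_max metric_sym xy xw.
apply: le_lt_trans (mdist_ultra z y w) _.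
by rewrite gt_max zy (lt_le_trans yw rs).
Qed.

Lemma openBall_nested (B C : openBall) x : ball_set B x -> ball_set C x ->
  B `<=` C \/ C `<=` B.
Proof.
have [y [r [_ ->]]] := ball_setP B; have [z [s [_ ->]]] := ball_setP C.
move=> Bx Cx.
have [rs|/ltW sr] := leP r s; [left|right].
  exact: ball_nested rs _ Bx Cx.
exact: ball_nested sr _ Cx Bx.
Qed.

Lemma is_fss1 : is_fss 1%g.
Proof.
move=> x.
have e : exists y r, 0 < r /\ ball x 1 = ball y r :> set X by exists x, 1.
exists (OpenBall e), (OpenBall e), id; split => //.
- exact: ballxx.
- by rewrite /= image_id.
- exact: Sim_id.
Qed.

Lemma is_fssV f : is_fss f -> is_fss f^-1%g.
Proof.
move=> hf x; have [B [B' [k [Bx fB kf Sk]]]] := hf (f^-1%g x).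
have [k' Sk' [kk' k'k]] := Sim_inv Sk.
have k'f y : val (k' y) = f^-1%g (val y).
  by rewrite -{2}(k'k y) kf; apply/esym; exact: homeoK.
exists B', B, k'; split => //; last exact: (fss_image Sk' k'f).
by rewrite -fB; exists (f^-1%g x) => //; exact: homeoVK.
Qed.

Lemma is_fssM f g : is_fss f -> is_fss g -> is_fss (f * g)%g.
Proof.
move=> hf hg x; have [B [B' [k [Bx fB kf Sk]]]] := hf x.
have [C [C' [l [Cx gC lg Sl]]]] := hg (f x).
have B'x : ball_set B' (f x) by rewrite -fB; exists x.
suff [D [D' [m [Dx mfg Sm]]]] : exists (D D' : openBall) (m : D -> D'),
    [/\ ball_set D x, forall y : D, val (m y) = g (f (val y)) & Sim S m].
  by exists D, D', m; split => //; exact: (fss_image (f := (f * g)%g) Sm).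
have [BC|CB] := openBall_nested B'x Cx.
- have [D [m [_ ml Sm]]] := Sim_restr Sl BC.
  exists B, D, (m \o k); split=> // [y|]; last exact: Sim_comp Sk Sm.
  rewrite /= -kf -(lg (el (BC _ (set_valP (k y))))) .
  exact: ml.
- have [k' Sk' [kk' k'k]] := Sim_inv Sk.
  have [D [m [Dm mk' Sm]]] := Sim_restr Sk' CB.
  have [m' Sm' [mm' m'm]] := Sim_inv Sm.
  exists D, C', (l \o m'); split; last exact: Sim_comp Sm' Sl.
  + rewrite Dm; exists (k (el Bx)); last by rewrite kk'.
    by rewrite /= kf.
  + move=> y /=; rewrite lg; congr (g _).
    pose z := el (CB _ (set_valP (m' y))).
    have e := mk' z (m' y) erefl; rewrite m'm in e.
    by rewrite e -kf k'k.
Qed.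

Definition fss_pred : {pred homeo X} := fun f => `[< is_fss f >].

Lemma fss_group_closed : group_closed fss_pred.
Proof.
split=> [|f g /asboolP fV /asboolP gV]; apply/asboolP; first exact: is_fss1.
by apply: is_fssM => //; exact: is_fssV.
Qed.

Definition FSSgroup := {f : homeo X | fss_pred f}.
HB.instance Definition _ := SubChoice.on FSSgroup.
HB.instance Definition _ :=
  SubChoice_isSubGroup.Build _ fss_pred FSSgroup fss_group_closed.

End FSS.

(* Main.v *)
Require Import Defs.
From HB Require Import structures.
From mathcomp Require Import all_boot all_order all_algebra all_fingroup finmap.
From mathcomp Require Import all_classical all_reals all_analysis.

(** Both groups act on a rooted tree, through a groupoid with finite sets of
    arrows. For tables the tree is the tree of binary words, and an arrow from
    [a] to [b] is a label in [H], which restricts to itself on the left child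
    and to its image under [theta] on the right child. For a compact
    ultrametric space the tree is formed by the balls, the children of a ball
    being its maximal proper subballs, and the arrows are the similarities of
    the structure. In both cases an element of the group carries all nodes
    beyond some finite subtree to nodes, along arrows ([treeAction]). The
    common result is [embeds_tree_action].

    Thompson's group replaces prefixes, whereas an arrow may permute children or
    carry a label that disappears further down. The remedy is to split each
    node [a] into blocks, which are sets of arrows from a base node to [a], so
    finite in number, and to give blocks parents in such a way that the arrows
    respect parents and that an arrow preserving a block fixes all its
    children. The direction matters: restriction of arrows may fail to
    be injective, so blocks cannot be refined downwards canonically, but a block
    below [a] always determines a block at [a] with the same stabilizer
    ([par], [par_act], [par_rep_inj]). An arrow then matches the children of a
    block with the children of its image in one way only, and matching children
    can be given the same word in a finite complete prefix code ([ext_act]).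
    Composing these words along the tree codes each block by a binary word, and
    an arrow replaces the code of a block, as a prefix, by the code of its
    image. Blocks whose line of descendants dies out are left out; every node
    keeps at least one block ([alive_exists]).

    So each element [g] replaces prefixes of all long words ([recode_total]), by
    a function of the word ([recode_fun]) compatible with products ([recodeM]),
    which makes it an element of Thompson's group ([embeds_prefix_action]). If
    that element is trivial, then [g] sends each node where it has a germ to a
    comparable one and preserves the living blocks of the nodes that it fixes.
    For balls, comparability already excludes that a point is moved. For tables,
    comparability of a node and its children forces all nodes to be fixed, and
    the labels are trivial because singleton blocks are living
    ([live_singleton]). *)

Set Implicit Arguments.
Unset Strict Implicit.
Unset Printing Implicit Defensive.

Local Open Scope classical_set_scope.

(** * Groups acting by prefix replacement *)

Lemma cat_eqP (T : eqType) (u u' x x' : seq T) : size u = size u' ->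
  u ++ x = u' ++ x' -> u = u' /\ x = x'.
Proof.
by move=> su /eqP; rewrite eqseq_cat // => /andP[/eqP -> /eqP ->].
Qed.

Lemma wcat_prefix_inj (u v : word) : (forall x, wcat u x = wcat v x) -> u = v.
Proof.
wlog le : u v / (size u <= size v)%N.
  move=> h e; have [le|/ltnW le] := leqP (size u) (size v); first exact: h.
  by apply/esym; apply: h.
move=> e; have [eq|lt] := leqP (size v) (size u).
  have su : size u = size v by apply/eqP; rewrite eqn_leq le eq.
  by have [] := wcat_inj su (e w0).
(* the entry of index [size u] is free on the left, determined on the right *)
have := congr1 (@^~ (size u)) (e (fun=> false)).
have := congr1 (@^~ (size u)) (e (fun=> true)).
by rewrite /wcat /= ltnn lt => <-.
Qed.

Lemma near_wtake n (x : cantor_space) :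
  nbhs x [set y | wtake n y = wtake n x].
Proof.
elim: n => [|n IH]; first by apply: filterS (@filterT _ (nbhs x) _) => y _.
have h := @proj_continuous _ (fun=> bool) n x [set x n] (discrete_set1 (x n)).
apply: filterS2 IH h => y /= e1 e2; rewrite -addn1 !wtakeD e1; congr (_ ++ _).
by rewrite /wtake /mkseq /= /wdrop addn0; congr [:: _].
Qed.

Lemma cantor_cvg (T : topologicalType) (f : T -> cantor_space) (x : T) :
  (forall n, nbhs x [set y | wtake n (f y) = wtake n (f x)]) -> f @ x --> f x.
Proof.
move=> h; apply/cvg_sup => i; apply/cvg_image => //.
  apply/seteqP; split=> // b _ /=; by exists (fun=> b).
move=> A /nbhs_singleton Ai; exists [set z : cantor_space | A (z i)]; last first.
  by apply/seteqP; split=> [b [z /= Az <-]//|b Ab]; exists (fun=> b).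
apply: filterS (h i.+1) => y /= /(congr1 (fun s => nth false s i)).
by rewrite !nth_mkseq // => ->.
Qed.

(** A homomorphism to [thompsonV], described on words only: the element [g]
    replaces prefixes of any sufficient length, with no preferred table, so
    that products need no common refinements. *)
Record prefix_action (G : groupType) := PrefixAction {
  prepl : G -> word -> word -> Prop;
  prepl_cat : forall g u v w, prepl g u v -> prepl g (u ++ w) (v ++ w);
  prepl_fun : forall g u v v', prepl g u v -> prepl g u v' -> v = v';
  prepl_total : forall g, exists n, forall u, size u = n -> exists v, prepl g u v;
  prepl1 : exists n, forall u, size u = n -> prepl 1%g u u;
  preplM : forall g h u v w,
    prepl g u v -> prepl h v w -> prepl (g * h)%g u w }.

Section PrefixAction.
Variables (G : groupType) (P : prefix_action G).
Let rho := prepl P.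

Definition pdepth g : nat := projT1 (cid (prepl_total P g)).

Lemma pdepthP g u : (pdepth g <= size u)%N -> exists v, rho g u v.
Proof.
move=> le; have [|v hv] := projT2 (cid (prepl_total P g)) (take (pdepth g) u).
  by rewrite size_takel.
by exists (v ++ drop (pdepth g) u); rewrite -{1}(cat_take_drop (pdepth g) u); apply: prepl_cat.
Qed.

Lemma pwordP g x : exists v, rho g (wtake (pdepth g) x) v.
Proof. by apply: pdepthP; rewrite size_wtake. Qed.

Definition pword g x : word := projT1 (cid (pwordP g x)).

Definition pfun g (x : cantor_space) : cantor_space :=
  wcat (pword g x) (wdrop (pdepth g) x).

Lemma pfunE g u v x : rho g u v -> pfun g (wcat u x) = wcat v x.
Proof.
move=> uv; rewrite /pfun; set y := wcat u x.
have := projT2 (cid (pwordP g y)); rewrite -/(pword g y) => uv'.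
pose d := pdepth g; pose m := (size u + d)%N.
have e1 : wtake m y = u ++ wtake d x.
  by rewrite wtakeD wtake_wcat wdrop_wcat.
have e2 : wtake m y = wtake d y ++ wtake (size u) (wdrop d y).
  by rewrite /m addnC wtakeD.
have ev : v ++ wtake d x = pword g y ++ wtake (size u) (wdrop d y).
  apply: (prepl_fun (prepl_cat (wtake d x) uv)).
  by rewrite -e1 e2; exact: prepl_cat.
rewrite -{1}(wcat_take_drop (size u) (wdrop d y)) -wcat_cat -ev wcat_cat; congr wcat.
rewrite -[RHS](wcat_take_drop d); congr wcat.
have -> : wdrop (size u) (wdrop d y) = wdrop d (wdrop (size u) y).
  by apply/funext => k; rewrite /wdrop !addnA (addnC d).
by rewrite wdrop_wcat.
Qed.

Lemma pfunM g h x : pfun (g * h)%g x = pfun h (pfun g x).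
Proof.
pose n := (pdepth g + pdepth h)%N.
have [v uv] : exists v, rho g (wtake n x) v.
  by apply: pdepthP; rewrite size_wtake leq_addr.
have [w vw] : exists w, rho h v w.
  apply: pdepthP; have [v0 uv0] := pwordP g x.
  have := prepl_cat (wtake (pdepth h) (wdrop (pdepth g) x)) uv0.
  rewrite -wtakeD => /(prepl_fun uv) ->.
  by rewrite size_cat size_wtake leq_addl.
rewrite -(wcat_take_drop n x) (pfunE _ uv) (pfunE _ vw).
by apply: pfunE; exact: preplM uv vw.
Qed.

Lemma pfun1 x : pfun 1%g x = x.
Proof.
have [n h] := prepl1 P; rewrite -{1}(wcat_take_drop n x) (@pfunE _ _ (wtake n x)).
  by rewrite wcat_take_drop.
by apply: h; rewrite size_wtake.
Qed.

Lemma pfunK g : cancel (pfun g) (pfun g^-1%g).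
Proof. by move=> x; rewrite -pfunM mulgV pfun1. Qed.

Lemma pfunVK g : cancel (pfun g^-1%g) (pfun g).
Proof. by move=> x; rewrite -pfunM mulVg pfun1. Qed.

Lemma pfun_continuous g : continuous (pfun g).
Proof.
move=> x; apply: cantor_cvg => n.
apply: filterS (near_wtake (pdepth g + n) x) => y /= e.
have [v uv] := pwordP g x.
have e' : wtake (pdepth g) y = wtake (pdepth g) x /\
    wtake n (wdrop (pdepth g) y) = wtake n (wdrop (pdepth g) x).
  by move: e; rewrite !wtakeD => /cat_eqP; rewrite !size_wtake => /(_ erefl).
rewrite -(wcat_take_drop (pdepth g) y) -(wcat_take_drop (pdepth g) x).
have [-> e2] := e'; rewrite !(pfunE _ uv) -(wcat_take_drop n (wdrop _ y)).
rewrite -[in RHS](wcat_take_drop n (wdrop _ x)) e2 -!wcat_cat.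
have le : (n <= size (v ++ wtake n (wdrop (pdepth g) x)))%N.
  by rewrite size_cat size_wtake leq_addl.
by apply/eq_in_map => i; rewrite mem_iota add0n /= => lt; rewrite /wcat (leq_trans lt le).
Qed.

Definition phomeo g : homeo cantor_space :=
  Homeo (@pfunK g) (@pfunVK g) (@pfun_continuous g) (@pfun_continuous g^-1%g).

Lemma phomeo_thompson g : phomeo g \in thompson_pred.
Proof.
apply/asboolP/is_thompsonP; exists (pdepth g) => u su.
have [v uv] : exists v, rho g u v by apply: pdepthP; rewrite su.
by exists v => x; exact: pfunE.
Qed.

Definition pthompson g : thompsonV := exist _ (phomeo g) (phomeo_thompson g).

Lemma pthompsonM : {morph pthompson : g h / (g * h)%g}.
Proof. by move=> g h; apply: val_inj; apply: homeoP => x; exact: pfunM. Qed.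

HB.instance Definition _ := isMultiplicative.Build G thompsonV pthompson pthompsonM.

Lemma embeds_prefix_action :
  (forall g, (forall u v, rho g u v -> u = v) -> g = 1%g) -> embeds G thompsonV.
Proof.
move=> faithful; exists pthompson => g h e.
apply/eqP; rewrite -[g == h]divg_eq1; apply/eqP; apply: faithful => u v uv.
apply: wcat_prefix_inj => x; rewrite -(pfunE x uv) pfunM.
have -> y : pfun g y = pfun h y by exact: (congr1 (fun f : thompsonV => val f y) e).
by rewrite pfunK.
Qed.

End PrefixAction.

(** * Finite sets and complete prefix codes *)

Lemma finite_powerset (T : choiceType) (A : set T) : finite_set A ->
  finite_set [set V : set T | V `<=` A].
Proof.
move=> fA; apply: (@sub_finite_set _ _
  ((fun f : {fset T} => [set` f]) @` [set` finmap.fpowerset (fset_set A)])).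
  move=> V VA; have fV := sub_finite_set VA fA.
  exists (fset_set V); last by rewrite fset_setK.
  rewrite /= finmap.fpowersetE; apply/finmap.fsubsetP => x.
  by rewrite !in_fset_set // !inE; exact: VA.
exact: finite_image.
Qed.

Lemma finite_decreasing (T : choiceType) (A : set T) (P : nat -> T -> Prop) :
  finite_set A -> (forall n x, P n.+1 x -> P n x) ->
  (forall n, exists2 x, A x & P n x) -> exists2 x, A x & forall n, P n x.
Proof.
move=> fA dec ne; apply: contrapT => h.
have {}h x : exists n, A x -> ~ P n x.
  have [Ax|?] := pselect (A x); last by exists 0%N.
  have /existsNP[n nP] : ~ forall n, P n x by move=> H; apply: h; exists x.
  by exists n.
pose f x := projT1 (cid (h x)).
pose N := (\max_(x <- fset_set A) f x)%N.
have [x Ax Px] := ne N; apply: (projT2 (cid (h x)) Ax); rewrite -/(f x).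
have le : (f x <= N)%N by apply: leq_bigmax_seq; rewrite // in_fset_set // inE.
by clear Ax; move: le; elim: N Px => [|n IH] Px;
  [by rewrite leqn0 => /eqP ->|rewrite leq_eqVlt => /orP[/eqP -> //|]; exact: IH (dec _ _ Px)].
Qed.

(** The codes 0, 10, 110, up to 1...10 and 1...1: the last entry gets no final
    0, so that every long word begins with a code; a single entry gets the
    empty code. *)
Fixpoint pcode (T : eqType) (s : seq T) (x : T) : word :=
  match s with
  | y :: (_ :: _) as s' => if x == y then [:: false] else true :: pcode s' x
  | _ => [::]
  end.

Lemma pcode_inj (T : eqType) (s : seq T) x y u v :
  x \in s -> y \in s -> pcode s x ++ u = pcode s y ++ v -> x = y.
Proof.
elim: s => // z [|z' s] IH; first by rewrite !inE => /eqP -> /eqP ->.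
rewrite [x \in _]inE [y \in _]inE.
case: (eqVneq x z) => [->|nx]; case: (eqVneq y z) => [->|ny] //= xs ys.
- by rewrite eqxx (negbTE ny).
- by rewrite eqxx (negbTE nx).
- by rewrite (negbTE nx) (negbTE ny) => -[]; exact: IH.
Qed.

Lemma pcode_total (T : eqType) (s : seq T) w :
  uniq s -> (0 < size s <= size w)%N -> exists x w', x \in s /\ w = pcode s x ++ w'.
Proof.
elim: s w => // z [|z' s] IH w /=; first by exists z, w; rewrite inE eqxx.
move=> /andP[zs us] le; case: w le => // [[] w] le; last by exists z, w; rewrite inE !eqxx.
have [x [w' [xs ->]]] := IH w us le; exists x, w'; rewrite inE xs orbT; split=> //.
by have [xz|//] := eqVneq x z; rewrite -xz xs in zs.
Qed.

(** * Finite groupoids over a rooted tree *)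

Inductive below (N : Type) (child : N -> N -> Prop) (a : N) : N -> Prop :=
| below_refl : below child a a
| below_child b c : below child a b -> child b c -> below child a c.

(** An arrow [k] from [a] to [b] is an isomorphism between the subtrees below
    [a] and [b], possibly with more data than its effect on nodes: it maps a
    child [c] of [a] to the child [move_kid k c] of [b], by the arrow
    [restr k c]. Composition is in diagrammatic order. Restriction need not be
    injective. *)
Record treeGroupoid := TreeGroupoid {
  node : choiceType;
  arrow : choiceType;
  root : node;
  child : node -> set node;
  ahom : arrow -> node -> node -> Prop;
  idar : node -> arrow;
  acomp : arrow -> arrow -> arrow;
  ainv : arrow -> arrow;
  move_kid : arrow -> node -> node;
  restr : arrow -> node -> arrow;
  child_fin : forall a, finite_set (child a);
  child_uniq : forall a b c, child a c -> child b c -> a = b;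
  child_root : forall a, ~ child a root;
  below_root : forall a, below child root a;
  hom_fin : forall a b, finite_set [set k | ahom k a b];
  hom_id : forall a, ahom (idar a) a a;
  hom_comp : forall k l a b c, ahom k a b -> ahom l b c -> ahom (acomp k l) a c;
  hom_inv : forall k a b, ahom k a b -> ahom (ainv k) b a;
  acompA : forall k l m a b c d, ahom k a b -> ahom l b c -> ahom m c d ->
    acomp k (acomp l m) = acomp (acomp k l) m;
  acomp1k : forall k a b, ahom k a b -> acomp (idar a) k = k;
  acompk1 : forall k a b, ahom k a b -> acomp k (idar b) = k;
  acompkV : forall k a b, ahom k a b -> acomp k (ainv k) = idar a;
  acompVk : forall k a b, ahom k a b -> acomp (ainv k) k = idar b;
  child_move : forall k a b c, ahom k a b -> child a c -> child b (move_kid k c);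
  hom_restr : forall k a b c, ahom k a b -> child a c -> ahom (restr k c) c (move_kid k c);
  move_id : forall a c, child a c -> move_kid (idar a) c = c;
  restr_id : forall a c, child a c -> restr (idar a) c = idar c;
  move_comp : forall k l a b d c, ahom k a b -> ahom l b d -> child a c ->
    move_kid (acomp k l) c = move_kid l (move_kid k c);
  restr_comp : forall k l a b d c, ahom k a b -> ahom l b d -> child a c ->
    restr (acomp k l) c = acomp (restr k c) (restr l (move_kid k c)) }.

Section Blocks.
Variable T : treeGroupoid.
Implicit Types (a b c : node T) (k l s : arrow T) (V W : set (arrow T)).
Local Notation "k ** l" := (acomp k l) (at level 40, left associativity).

Definition leaf a := forall c, ~ child a c.

Lemma leaf_hom k a b : ahom k a b -> leaf a -> leaf b.
Proof. by move=> h la c /(child_move (hom_inv h)) /la. Qed.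

(** A representative of the isomorphism class of [a]; the default of [xget] is
    constant, so it depends on the class only. *)
Definition base a : node T := xget (root T) [set b | exists k, ahom k b a].

Lemma base_hom a : exists s, ahom s (base a) a.
Proof.
rewrite /base; case: xgetP => [b _ //|/(_ a)[]].
by exists (idar a); exact: hom_id.
Qed.

Lemma base_eq k a b : ahom k a b -> base b = base a.
Proof.
move=> h; rewrite /base; congr (xget _ _); apply/seteqP; split=> c [l hl].
  by exists (l ** ainv k); apply: hom_comp hl (hom_inv h).
by exists (l ** k); apply: hom_comp hl h.
Qed.

(** Blocks refine nodes: a block at [a] is a set of arrows from the base node to
    [a], on which the arrows out of [a] act by composition. Every group
    of arrows from [a] to [a] is the stabilizer of some block, which is what
    makes the parent map below possible. *)
Definition block := (node T * set (arrow T))%type.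
Implicit Types x y z : block.

Definition is_block y := forall w, y.2 w -> ahom w (base y.1) y.1.

Definition tr V k := [set w ** k | w in V].
Definition bact k y : block := (move_kid k y.1, tr y.2 (restr k y.1)).
Definition subblock a y := child a y.1 /\ is_block y.

Lemma is_block_tr a b k V : is_block (a, V) -> ahom k a b -> is_block (b, tr V k).
Proof.
by move=> bV h _ [w Vw <-] /=; rewrite (base_eq h); apply: hom_comp h; exact: bV.
Qed.

Lemma tr_comp a b c k l V : is_block (a, V) -> ahom k a b -> ahom l b c ->
  tr (tr V k) l = tr V (k ** l).
Proof.
move=> bV hk hl; apply/seteqP; split=> [_ [_ [w Vw <-] <-]|_ [w Vw <-]].
  by exists w => //; apply: acompA hk hl; exact: bV.
exists (w ** k); first by exists w.
by apply/esym; apply: acompA hk hl; exact: bV.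
Qed.

Lemma tr_id a V : is_block (a, V) -> tr V (idar a) = V.
Proof.
move=> bV; apply/seteqP; split=> [_ [w Vw <-]|w Vw].
  by rewrite (acompk1 (bV _ Vw)).
by exists w => //; rewrite (acompk1 (bV _ Vw)).
Qed.

Lemma trK a b k V : is_block (a, V) -> ahom k a b -> tr (tr V k) (ainv k) = V.
Proof.
by move=> bV h; rewrite (tr_comp bV h (hom_inv h)) (acompkV h) tr_id.
Qed.

Lemma inv_hom_id a b k l : ahom k a b -> ahom l b a -> k ** l = idar a -> l = ainv k.
Proof.
move=> hk hl e; rewrite -(acomp1k hl) -(acompVk hk).
by rewrite -(acompA (hom_inv hk) hk hl) e (acompk1 (hom_inv hk)).
Qed.

Lemma subblock_act k a b y : ahom k a b -> subblock a y -> subblock b (bact k y).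
Proof.
case: y => c W h [/= ac bW]; split=> /=; first exact: (child_move h ac).
by apply: is_block_tr bW _; exact: hom_restr h ac.
Qed.

Lemma act_comp k l a b d y : ahom k a b -> ahom l b d -> subblock a y ->
  bact l (bact k y) = bact (k ** l) y.
Proof.
case: y => c W hk hl [/= ac bW]; rewrite /bact /= (move_comp hk hl ac).
by rewrite (restr_comp hk hl ac) (tr_comp bW (hom_restr hk ac) (hom_restr hl (child_move hk ac))).
Qed.

Lemma act_id a y : subblock a y -> bact (idar a) y = y.
Proof.
by case: y => c W [/= ac bW]; rewrite /bact /= (move_id ac) (restr_id ac) tr_id.
Qed.

Lemma actK k a b y : ahom k a b -> subblock a y -> bact (ainv k) (bact k y) = y.
Proof. by move=> h sy; rewrite (act_comp h (hom_inv h) sy) (acompkV h) act_id. Qed.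

Lemma actVK k a b y : ahom k a b -> subblock b y -> bact k (bact (ainv k) y) = y.
Proof. by move=> h sy; rewrite (act_comp (hom_inv h) h sy) (acompVk h) act_id. Qed.

(** Each block [y] just below [a] gets a parent block at [a], equivariantly and
    without changing the stabilizer: take the orbit of [y] transported below
    the base node, pick one [rep] in it by a choice that depends on the
    orbit only, and let the parent consist of the arrows that carry this
    choice to [y]. *)
Definition orb a y := [set bact (ainv s) y | s in [set s | ahom s (base a) a]].
Definition rep a y : block := xget (root T, set0) (orb a y).
Definition par a y := [set s | ahom s (base a) a /\ bact (ainv s) y = rep a y].

Lemma inv_comp k l a b d : ahom k a b -> ahom l b d -> ainv (k ** l) = ainv l ** ainv k.
Proof.
move=> hk hl; apply/esym; apply: (inv_hom_id (hom_comp hk hl)).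
  by apply: hom_comp (hom_inv hl) (hom_inv hk).
rewrite (acompA (hom_comp hk hl) (hom_inv hl) (hom_inv hk)).
by rewrite -(acompA hk hl (hom_inv hl)) (acompkV hl) (acompk1 hk) (acompkV hk).
Qed.

Lemma act_inv_comp k s a b d y : ahom s d a -> ahom k a b -> subblock a y ->
  bact (ainv (s ** k)) (bact k y) = bact (ainv s) y.
Proof.
move=> hs hk sy; rewrite (inv_comp hs hk).
rewrite -(act_comp (hom_inv hk) (hom_inv hs)); last exact: subblock_act hk sy.
by rewrite (actK hk).
Qed.

Lemma comp_invK k s a b d : ahom s d b -> ahom k a b -> (s ** ainv k) ** k = s.
Proof. by move=> hs hk; rewrite -(acompA hs (hom_inv hk) hk) (acompVk hk) (acompk1 hs). Qed.

Lemma orb_act k a b y : ahom k a b -> subblock a y -> orb b (bact k y) = orb a y.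
Proof.
move=> hk sy; apply/seteqP; split=> [_ [s /= hs <-]|_ [s /= hs <-]].
  rewrite (base_eq hk) in hs; exists (s ** ainv k) => /=.
    exact: hom_comp hs (hom_inv hk).
  by rewrite -(act_inv_comp (hom_comp hs (hom_inv hk)) hk sy) (comp_invK hs hk).
exists (s ** k); last exact: act_inv_comp hs hk sy.
by rewrite /= (base_eq hk); apply: hom_comp hs hk.
Qed.

Lemma rep_act k a b y : ahom k a b -> subblock a y -> rep b (bact k y) = rep a y.
Proof. by move=> hk sy; rewrite /rep (orb_act hk). Qed.

Lemma par_act k a b y : ahom k a b -> subblock a y ->
  par b (bact k y) = tr (par a y) k.
Proof.
move=> hk sy; apply/seteqP; split=> [s []|_ [s [hs es] <-]].
  rewrite (base_eq hk) (rep_act hk sy) => hs es.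
  have hs' := hom_comp hs (hom_inv hk).
  exists (s ** ainv k); last exact: comp_invK hs hk.
  by split=> //; rewrite -es -(act_inv_comp hs' hk sy) (comp_invK hs hk).
split; first by rewrite (base_eq hk); apply: hom_comp hs hk.
by rewrite (rep_act hk sy) -es; exact: act_inv_comp hs hk sy.
Qed.

Lemma par_block a y : is_block (a, par a y).
Proof. by move=> s []. Qed.

Lemma par_nonempty a y : exists s, par a y s.
Proof.
suff : orb a y (rep a y) by move=> [s hs es]; exists s.
have [s hs] := base_hom a; apply: xgetPex.
by exists (bact (ainv s) y), s.
Qed.

(** Two arrows of the parent carry [rep] to the same block, so an arrow that
    preserves the parent fixes the child: children of a block are told apart
    by [rep], which no arrow changes. *)
Lemma par_rep_inj a y z : subblock a y -> subblock a z ->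
  par a y = par a z -> rep a y = rep a z -> y = z.
Proof.
move=> sy sz ep er; have [s sy'] := par_nonempty a y.
have [hs ey] := sy'; have [_ ez] : par a z s by rewrite -ep.
by rewrite -(actVK hs sy) -(actVK hs sz) ey ez er.
Qed.

(** Parents are defined from children, so a block may have no children at a
    node that has some. Only blocks with descendants down to a leaf or at
    every depth carry points of the limit space; the others get no code. *)
Fixpoint live n a V : Prop :=
  if n is n'.+1 then
    leaf a \/ exists y, [/\ subblock a y, par a y = V & live n' y.1 y.2]
  else True.

Definition alive a V := forall n, live n a V.

Lemma live_tr n k a b V : ahom k a b -> live n a V -> live n b (tr V k).
Proof.
elim: n k a b V => //= n IH k a b V hk [la|[y [sy py ly]]].
  by left; exact: leaf_hom hk la.
right; exists (bact k y); split; first exact: subblock_act hk sy.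
  by rewrite (par_act hk) // py.
by apply: IH ly; apply: (hom_restr hk); case: sy.
Qed.

Lemma alive_tr k a b V : ahom k a b -> alive a V -> alive b (tr V k).
Proof. by move=> hk aV n; exact: live_tr hk (aV n). Qed.

Lemma live_dec n a V : live n.+1 a V -> live n a V.
Proof.
elim: n a V => // n IH a V [la|[y [sy py ly]]]; first by left.
by right; exists y; split => //; exact: IH.
Qed.

Lemma alive_par a y : subblock a y -> alive y.1 y.2 -> alive a (par a y).
Proof. by move=> sy ay [|n] //=; right; exists y. Qed.

Lemma block_fin a : finite_set [set y : block | y.1 = a /\ is_block y].
Proof.
apply: (@sub_finite_set _ _ ((fun V => (a, V)) @`
  [set V | V `<=` [set k | ahom k (base a) a]])).
  by move=> [_ V] [/= -> bV]; exists V.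
by apply: finite_image; apply: finite_powerset; exact: hom_fin.
Qed.

Lemma subblock_fin a : finite_set (subblock a).
Proof.
apply: (@sub_finite_set _ _
  (\bigcup_(c in child a) [set y : block | y.1 = c /\ is_block y])).
  by move=> y [ay by_]; exists y.1.
by apply: bigcup_finite => [|c _]; [exact: child_fin|exact: block_fin].
Qed.

Lemma alive_child a V : alive a V -> ~ leaf a ->
  exists y, [/\ subblock a y, par a y = V & alive y.1 y.2].
Proof.
move=> aV la.
have [|||y [sy py] ly] := @finite_decreasing _ (subblock a `&` [set y | par a y = V])
  (fun n y => live n y.1 y.2).
- apply: sub_finite_set (subblock_fin a); exact: subIsetl.
- by move=> n y; exact: live_dec.
- by move=> n; have [//|[y [sy py ly]]] := aV n.+1; exists y.
by exists y.
Qed.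

(** A block at depth [n] below [a] has a chain of parents up to [a]; as [a] has
    only finitely many blocks, one of them serves for all [n]. *)
Lemma alive_exists a : exists2 V, is_block (a, V) & alive a V.
Proof.
have [||y [ya yb] ly] := @finite_decreasing _
    [set y : block | y.1 = a /\ is_block y] (fun n y => live n y.1 y.2) (block_fin a).
- by move=> n y; exact: live_dec.
- move=> n; suff [V bV lV] : exists2 V, is_block (a, V) & live n a V by exists (a, V).
  elim: n a => [|n IH] a; first by exists set0.
  have [la|/existsNP[c /contrapT ac]] := pselect (leaf a).
    by exists set0 => //; left.
  have [W bW lW] := IH c; have sW : subblock a (c, W) by [].
  exists (par a (c, W)); first exact: par_block.
  by right; exists (c, W).
by case: y ya yb ly => _ V /= -> yb ly; exists V.
Qed.

Definition kids a V := [set y | [/\ subblock a y, par a y = V & alive y.1 y.2]].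
Definition kinds a V := rep a @` kids a V.

Lemma kids_tr k a b V : ahom k a b -> is_block (a, V) ->
  kids b (tr V k) = bact k @` kids a V.
Proof.
move=> hk bV; apply/seteqP; split=> [y [sy py ay]|_ [y [sy py ay] <-]].
  have sy' := subblock_act (hom_inv hk) sy.
  exists (bact (ainv k) y); last exact: actVK hk sy.
  split=> //; first by rewrite (par_act (hom_inv hk) sy) py (trK bV hk).
  by apply: alive_tr ay; apply: (hom_restr (hom_inv hk)); case: sy.
split; first exact: subblock_act hk sy.
  by rewrite (par_act hk sy) py.
by apply: alive_tr ay; apply: (hom_restr hk); case: sy.
Qed.

Lemma kinds_tr k a b V : ahom k a b -> is_block (a, V) ->
  kinds b (tr V k) = kinds a V.
Proof.
move=> hk bV; rewrite /kinds (kids_tr hk bV) image_comp.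
by apply: eq_imagel => y [sy _ _]; exact: rep_act hk sy.
Qed.

Lemma kids_fin a V : finite_set (kids a V).
Proof. by apply: sub_finite_set (subblock_fin a) => y []. Qed.

Lemma kinds_fin a V : finite_set (kinds a V).
Proof. by apply: finite_image; exact: kids_fin. Qed.

Definition qcode (U : choiceType) (Q : set U) (q : U) := pcode (fset_set Q) q.

Lemma qcode_inj (U : choiceType) (Q : set U) p q u v : finite_set Q ->
  Q p -> Q q -> qcode Q p ++ u = qcode Q q ++ v -> p = q.
Proof. by move=> fQ Qp Qq; apply: pcode_inj; rewrite in_fset_set // inE. Qed.

Lemma qcode_total (U : choiceType) (Q : set U) : finite_set Q -> Q !=set0 ->
  exists n, forall w, (n <= size w)%N ->
  exists q w', Q q /\ w = qcode Q q ++ w'.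
Proof.
move=> fQ [q Qq]; exists (size (fset_set Q)) => w le.
have [||p [w' [pQ ->]]] := @pcode_total _ (fset_set Q) w.
- exact: fset_uniq.
- by rewrite le andbT cardfs_gt0; apply/fset0Pn; exists q; rewrite in_fset_set // inE.
by exists p, w'; split => //; move: pQ; rewrite in_fset_set // inE.
Qed.

(** The word that a child appends to the code of its parent. It depends only on
    data invariant under arrows, so that an arrow which recodes the parent
    recodes its children by the same prefix replacement, see [ext_act]. *)
Definition ext a y : word := qcode (kinds a (par a y)) (rep a y).

Lemma ext_act k a b y : ahom k a b -> subblock a y -> ext b (bact k y) = ext a y.
Proof.
move=> hk sy; rewrite /ext (rep_act hk sy) (par_act hk sy) (kinds_tr hk) //.
exact: par_block.
Qed.

Lemma ext_inj a V y z u v : kids a V y -> kids a V z ->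
  ext a y ++ u = ext a z ++ v -> y = z.
Proof.
move=> ky kz; have [sy py ay] := ky; have [sz pz az] := kz.
rewrite /ext py pz => e; apply: (par_rep_inj sy sz); first by rewrite py pz.
by apply: (qcode_inj _ _ _ e); [exact: kinds_fin|exists y|exists z].
Qed.

Lemma ext_total a V : alive a V -> ~ leaf a -> exists n, forall w,
  (n <= size w)%N -> exists y w', kids a V y /\ w = ext a y ++ w'.
Proof.
move=> aV la; have [y ky] := alive_child aV la.
have [|n h] := qcode_total (@kinds_fin a V); first by exists (rep a y), y.
exists n => w /h [_ [w' [[z kz <-] ->]]]; exists z, w'; split => //.
by have [_ pz _] := kz; rewrite /ext pz.
Qed.

Inductive descends (x : block) : nat -> block -> word -> Prop :=
| descends0 : descends x 0 x [::]
| descendsS n y z e : descends x n y e -> kids y.1 y.2 z ->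
    descends x n.+1 z (e ++ ext y.1 z).

Definition tops := [set y : block | [/\ y.1 = root T, is_block y & alive y.1 y.2]].

Lemma tops_fin : finite_set tops.
Proof. by apply: sub_finite_set (block_fin (root T)) => y []. Qed.

Inductive coded : nat -> block -> word -> Prop :=
| coded0 y : tops y -> coded 0 y (qcode tops y)
| codedS n y z u : coded n y u -> kids y.1 y.2 z -> coded n.+1 z (u ++ ext y.1 z).

Lemma coded_block n y u : coded n y u -> is_block y /\ alive y.1 y.2.
Proof. by case=> [z []|{}n {}y z {}u _ [[]]]. Qed.


Lemma coded_fun n m y z u v : coded n y u -> coded m z v -> y.1 = z.1 ->
  n = m /\ (y = z -> u = v).
Proof.
move=> h; elim: h m z v => {n y u} [y ty|n y z u cy IH kz] m z' v h e.
  case: h e => [z tz _|{}m y' {}z {}v _ [[ch _] _ _] e]; first by split=> // ->.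
  by have [root_y _ _] := ty; case: (@child_root T y'.1); rewrite -root_y e.
case: h e => [{}z' [rz _ _] e|{}m y' {}z' {}v cy' kz' e].
  by have [[ch _] _ _] := kz; case: (@child_root T y.1); rewrite -rz -e.
have [[ch _] py _] := kz; have [[ch' _] py' _] := kz'.
have ey : y.1 = y'.1 by apply: child_uniq ch _; rewrite e.
have [-> euv] := IH _ _ _ cy' ey; split=> // ez; subst z'.
have eyy : y = y'.
  by rewrite [y]surjective_pairing [y']surjective_pairing -py -py' ey.
by rewrite -(euv eyy) eyy.
Qed.

Lemma coded_level n y z u v p q : coded n y u -> coded n z v ->
  u ++ p = v ++ q -> y = z.
Proof.
move=> h; elim: h z v p q => {n y u} [y ty|n y y' u cy IH ky] z v p q h.
  move Dn: 0%N h => n' h; case: h Dn => // {}z tz _.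
  by apply: qcode_inj ty tz; exact: tops_fin.
move Dn: n.+1 h => n' h; case: h Dn => // m z' {}z {}v cz kz [en]; subst m.
rewrite -!catA => e; have ez := IH _ _ _ _ cz e; subst z'.
have [_ euv] := coded_fun cy cz erefl; move: e; rewrite (euv erefl) => /cat_eqP.
by move=> /(_ erefl)[_]; exact: ext_inj ky kz.
Qed.

Lemma coded_descends n m y z u e : coded n y u -> descends y m z e ->
  coded (n + m) z (u ++ e).
Proof.
move=> cy; elim=> [|{}m z' {}z {}e _ IH kz]; first by rewrite addn0 cats0.
by rewrite addnS catA; exact: codedS.
Qed.

Lemma coded_ancestor n m z v : coded (n + m) z v ->
  exists y u e, [/\ coded n y u, descends y m z e & v = u ++ e].
Proof.
elim: m z v => [|m IH] z v.
  by rewrite addn0 => cz; exists z, v, [::]; split; rewrite ?cats0 //; exact: descends0.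
rewrite addnS; move Dn: (n + m).+1 => n' h; case: h Dn => // k y {}z u cy kz [en].
subst k; have [x [w [e [cx dx ->]]]] := IH _ _ cy.
by exists x, w, (e ++ ext y.1 z); split; rewrite ?catA //; exact: descendsS.
Qed.

Lemma coded_exists y : is_block y -> alive y.1 y.2 -> exists n u, coded n y u.
Proof.
case: y => a V; elim: (below_root a) V => {a} [|a c _ IH ac] V bV aV.
  by exists 0%N, (qcode tops (root T, V)); exact: coded0.
have sV : subblock a (c, V) by [].
have [n [u cu]] := IH _ (@par_block a (c, V)) (alive_par sV aV).
by exists n.+1, (u ++ ext a (c, V)); apply: (codedS cu).
Qed.

Lemma descends_below n y z e : descends y n z e -> below (@child T) y.1 z.1.
Proof.
elim=> [|{}n z' {}z {}e _ IH [[ch _] _ _]]; first exact: below_refl.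
exact: below_child IH ch.
Qed.

(** Codes grow by the empty word along blocks with a single child, so equal
    codes only imply that one of the blocks is an ancestor of the other. *)
Lemma coded_nested n m y z u v p q : coded n y u -> coded m z v ->
  u ++ p = v ++ q ->
  (exists i e, [/\ descends y i z e, v = u ++ e & p = e ++ q]) \/
  (exists i e, [/\ descends z i y e, u = v ++ e & q = e ++ p]).
Proof.
wlog le : n m y z u v p q / (n <= m)%N.
  move=> h cy cz e; have [le|/ltnW le] := leqP n m; first exact: (h n m).
  by have [H|H] := h m n z y v u q p le cz cy (esym e); [right|left].
move=> cy cz e; left; move: cz; rewrite -(subnKC le) => /coded_ancestor.
move=> [y' [u' [w [cy' dz ev]]]]; subst v; rewrite -catA in e.
have ey := coded_level cy cy' e; subst y'.
have [_ /(_ erefl) eu] := coded_fun cy cy' erefl; subst u'.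
by exists (m - n)%N, w; split=> //; have [] := cat_eqP erefl e.
Qed.

End Blocks.

(** [germ g a b k] means that [g] carries the subtree below [a] to the one below
    [b] along [k]. The bar condition [germ_bar] expresses that every branch of
    the tree meets a node with a germ of [g]. *)
Record treeAction (T : treeGroupoid) (G : groupType) := TreeAction {
  germ : G -> node T -> node T -> arrow T -> Prop;
  germ_hom : forall g a b k, germ g a b k -> ahom k a b;
  germ_fun : forall g a b b' k k', germ g a b k -> germ g a b' k' ->
    b = b' /\ k = k';
  germ_child : forall g a b k c, germ g a b k -> child a c ->
    germ g c (move_kid k c) (restr k c);
  germ1 : germ 1%g (root T) (root T) (idar (root T));
  germM : forall g h a b c k l, germ g a b k -> germ h b c l ->
    germ (g * h)%g a c (acomp k l);
  germ_bar : forall g (P : node T -> Prop),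
    (forall a b k, germ g a b k -> P a) ->
    (forall a, ~ leaf a -> (forall c, child a c -> P c) -> P a) -> P (root T) }.

Section TreeAction.
Variables (T : treeGroupoid) (G : groupType) (A : treeAction T G).
Let germ := germ A.

Lemma kids_act (a b : node T) k V z : ahom k a b -> is_block (a, V) -> kids a V z ->
  kids b (tr V k) (bact k z).
Proof. by move=> hk bV kz; rewrite (kids_tr hk bV); exists z. Qed.

Lemma descends_germ g a b k V n z e : germ g a b k -> is_block (a, V) ->
  descends (a, V) n z e -> exists b' k', [/\ is_block z, germ g z.1 b' k'
    & descends (b, tr V k) n (b', tr z.2 k') e].
Proof.
move=> gk bV; elim=> [|{}n y {}z {}e _ [b' [k' [by_ gk' d]]] kz].
  by exists b, k; split=> //; exact: descends0.
have [sz py az] := kz; have [ch bz] := sz; have hk' := germ_hom gk'.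
exists (move_kid k' z.1), (restr k' z.1); split=> //; first exact: germ_child gk' ch.
rewrite -(ext_act hk' sz); apply: (descendsS d).
exact: (kids_act hk' by_ kz).
Qed.

(** Pulling descendants back along a germ is needed for products: the second
    factor may have its germs at nodes deeper than the image of the first. *)
Lemma germ_descends g a b k V n z e : germ g a b k -> is_block (a, V) ->
  descends (b, tr V k) n z e -> exists a' k' W, [/\ is_block (a', W),
    germ g a' z.1 k', z.2 = tr W k' & descends (a, V) n (a', W) e].
Proof.
move=> gk bV; elim=> [|{}n y {}z {}e _ [a' [k' [W [bW gk' ey d]]]] kz].
  by exists a, k, V; split=> //; exact: descends0.
have hk' := germ_hom gk'; have hV := hom_inv hk'.
have [sz py az] := kz; have sz' := subblock_act hV sz.
have [ch bx] := sz'; have ez := actVK hk' sz.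
have kx : kids a' W (bact (ainv k') z).
  rewrite -(trK bW hk') -ey; apply: kids_act hV _ kz.
  by rewrite ey; exact: is_block_tr bW hk'.
exists (bact (ainv k') z).1, (restr k' (bact (ainv k') z).1), (bact (ainv k') z).2.
have ext_z := ext_act hV sz; move: (bact (ainv k') z) sz' ch bx ez kx ext_z.
move=> x _ ch bx <- kx <-; split=> //; first exact: germ_child gk' ch.
by rewrite -surjective_pairing; exact: descendsS d kx.
Qed.

Definition recode g (u v : word) := exists a b k V n m u0 v0 r,
  [/\ germ g a b k, coded n (a, V) u0, coded m (b, tr V k) v0,
      u = u0 ++ r & v = v0 ++ r].

Lemma recode_cat g u v w : recode g u v -> recode g (u ++ w) (v ++ w).
Proof.
move=> [a [b [k [V [n [m [u0 [v0 [r [gk cu cv -> ->]]]]]]]]]].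
by exists a, b, k, V, n, m, u0, v0, (r ++ w); split; rewrite ?catA.
Qed.

Lemma coded_is_block (a : node T) V n u : coded n (a, V) u -> is_block (a, V).
Proof. by move=> /coded_block[]. Qed.

Lemma coded_word (y : block T) n m u v : coded n y u -> coded m y v -> u = v.
Proof. by move=> cu cv; have [_ e] := coded_fun cu cv erefl; exact: e. Qed.

(** Two germs of [g] that apply to the same word sit at nested blocks, and the
    deeper one is a restriction of the other. *)
Lemma recode_fun g u v v' : recode g u v -> recode g u v' -> v = v'.
Proof.
move=> [a [b [k [V [n [m [u0 [v0 [r [gk cu cv eu ->]]]]]]]]]].
move=> [a' [b' [k' [V' [n' [m' [u0' [v0' [r' [gk' cu' cv' eu' ->]]]]]]]]]].
have e : u0 ++ r = u0' ++ r' by rewrite -eu -eu'.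
wlog [i [w [d ew er]]] : a b k V n m u0 v0 r gk cu cv eu
    a' b' k' V' n' m' u0' v0' r' gk' cu' cv' eu' e /
    exists i w, [/\ descends (a, V) i (a', V') w, u0' = u0 ++ w & r = w ++ r'].
  move=> h; have [H|H] := coded_nested cu cu' e; last apply/esym.
    exact: (h _ _ _ _ _ _ _ _ _ gk cu cv eu _ _ _ _ _ _ _ _ _ gk' cu' cv' eu' e H).
  exact: (h _ _ _ _ _ _ _ _ _ gk' cu' cv' eu' _ _ _ _ _ _ _ _ _ gk cu cv eu (esym e) H).
have [b2 [k2 [_ gk2 d2]]] := descends_germ gk (coded_is_block cu) d.
have [eb ek] := germ_fun gk2 gk'; subst b2 k2.
by rewrite (coded_word cv' (coded_descends cv d2)) er catA.
Qed.

Lemma coded_germ g (a b : node T) k V n u : germ g a b k -> coded n (a, V) u ->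
  exists m v, coded m (b, tr V k) v.
Proof.
move=> gk cu; have [bV aV] := coded_block cu; have hk := germ_hom gk.
by apply: coded_exists; [exact: is_block_tr bV hk|exact: alive_tr hk aV].
Qed.

(** At a node where [g] has no germ yet, a long word singles out a living child
    block; the finitely many children have a common bound. *)
Lemma recode_total g : exists n, forall u, size u = n -> exists v, recode g u v.
Proof.
pose P (a : node T) := forall V n u, coded n (a, V) u ->
  exists N, forall w, (N <= size w)%N -> exists v, recode g (u ++ w) v.
have : P (root T).
  apply: (germ_bar (g := g)) => [a b k gk|a la IH] V n u cu.
    exists 0%N => w _; have [m [v cv]] := coded_germ gk cu.
    by exists (v ++ w), a, b, k, V, n, m, u, v, w.
  have [N hN] := ext_total (coded_block cu).2 la.
  have {}IH y : exists M, kids a V y ->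
      forall w, (M <= size w)%N -> exists v, recode g (u ++ ext a y ++ w) v.
    have [ky|?] := pselect (kids a V y); last by exists 0%N.
    have cy := codedS cu ky; have [[ch _] _ _] := ky.
    case: y ky cy ch => c W ky /= cy ch; have [M hM] := IH c ch _ _ _ cy.
    by exists M => _ w /hM; rewrite catA.
  pose M y := projT1 (cid (IH y)); have MP y := projT2 (cid (IH y)).
  pose K := fset_set (kids a V).
  exists (N + \max_(y <- K) (size (ext a y) + M y))%N => w le.
  have [|y [w' [ky ew]]] := hN w; first exact: leq_trans (leq_addr _ _) le.
  rewrite ew; apply: (MP y) => //.
  have yK : y \in K by rewrite in_fset_set ?inE //; exact: kids_fin.
  rewrite -(leq_add2l (size (ext a y))) -size_cat -ew.
  apply: leq_trans le; apply: leq_trans (leq_addl _ _).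
  exact: (@leq_bigmax_seq _ _ _ (fun y => size (ext a y) + M y)%N).
move=> hP; have [|N hN] := qcode_total (tops_fin T).
  by have [V bV aV] := alive_exists (root T); exists (root T, V).
have {}hP (y : block T) : exists M, tops y ->
    forall w, (M <= size w)%N -> exists v, recode g (qcode (tops (T:=T)) y ++ w) v.
  have [ty|?] := pselect (tops y); last by exists 0%N.
  have cy := coded0 ty; case: y ty cy => c W ty cy; have [/= ec _ _] := ty.
  by rewrite {1}ec in cy; have [M hM] := hP _ _ _ cy; exists M.
pose M y := projT1 (cid (hP y)); have MP y := projT2 (cid (hP y)).
pose K := fset_set (tops (T:=T)).
exists (N + \max_(y <- K) (size (qcode (tops (T:=T)) y) + M y))%N => w le.
have [|y [w' [ty ew]]] := hN w; first by rewrite le leq_addr.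
rewrite ew; apply: (MP y) => //.
have yK : y \in K by rewrite in_fset_set ?inE //; exact: tops_fin T.
rewrite -(leq_add2l (size (qcode (tops (T:=T)) y))) -size_cat -ew le.
apply: leq_trans (leq_addl _ _).
exact: (@leq_bigmax_seq _ _ _ (fun y => size (qcode (tops (T:=T)) y) + M y)%N).
Qed.

Lemma recodeM g h u v w : recode g u v -> recode h v w -> recode (g * h)%g u w.
Proof.
move=> [a [b [k [V [n [m [u0 [v0 [r [gk cu cv -> ->]]]]]]]]]].
move=> [b' [c [l [W [n' [m' [v0' [w0 [r' [hl cv' cw e ->]]]]]]]]]].
have [hk hl'] := (germ_hom gk, germ_hom hl).
have bV := coded_is_block cu.
have [[i [x [d ev er]]]|[i [x [d ev er]]]] := coded_nested cv cv' e.
  have [a' [k' [V' [bV' gk' /= eW da]]]] := germ_descends gk bV d.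
  exists a', c, (acomp k' l), V', (n + i)%N, m', (u0 ++ x), w0, r'; split=> //.
  - exact: germM gk' hl.
  - exact: coded_descends cu da.
  - by rewrite -(tr_comp bV' (germ_hom gk') hl') -eW.
  - by rewrite er catA.
have [c' [l' [_ /= hl2 dc]]] := descends_germ hl (coded_is_block cv') d.
exists a, c', (acomp k l'), V, n, (m' + i)%N, u0, (w0 ++ x), r; split=> //.
- exact: germM gk hl2.
- rewrite -(tr_comp bV hk (germ_hom hl2)); exact: coded_descends cw dc.
- by rewrite er catA.
Qed.

Lemma recode1 : exists n, forall u, size u = n -> recode 1%g u u.
Proof.
have [|N hN] := qcode_total (tops_fin T).
  by have [V bV aV] := alive_exists (root T); exists (root T, V).
exists N => u su; have [|[a V] [w [ty ->]]] := hN u; first by rewrite su.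
have ca := coded0 ty; have [/= ea bV aV] := ty; subst a.
exists (root T), (root T), (idar (root T)), V, 0%N, 0%N, (qcode (tops (T:=T)) (root T, V)).
exists (qcode (tops (T:=T)) (root T, V)), w; split=> //; first exact: germ1.
by rewrite (tr_id bV).
Qed.

Definition recode_action :=
  PrefixAction recode_cat recode_fun recode_total recode1 recodeM.

(** Equal codes force nested blocks, and equality for blocks at the same node. So
    the condition on [g] in the hypothesis is what follows when [g] acts
    trivially on the Cantor space. *)
Theorem embeds_tree_action :
  (forall g, (forall a b k V, germ g a b k -> is_block (a, V) -> alive a V ->
      (below (@child T) a b \/ below (@child T) b a) /\ (a = b -> tr V k = V)) ->
    g = 1%g) ->
  embeds G thompsonV.
Proof.
move=> faithful; apply: (embeds_prefix_action (P := recode_action)) => g fix_g.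
apply: faithful => a b k V gk bV aV.
have [n [u cu]] := coded_exists bV aV; have [m [v cv]] := coded_germ gk cu.
have euv : u = v by apply: fix_g; exists a, b, k, V, n, m, u, v, [::]; rewrite !cats0.
subst v; split.
  have [[i [e [/descends_below H _ _]]]|[i [e [/descends_below H _ _]]]] :=
    coded_nested cu cv (erefl (u ++ [::])); [by left|by right].
move=> eab; subst b; have [enm _] := coded_fun cu cv erefl; subst m.
by have [] := coded_level cu cv (erefl (u ++ [::])).
Qed.

End TreeAction.

(** * The groups of tables labelled by a finite group *)

Section VHtree.
Variables (H : finGroupType) (theta : {multiplicative H -> H}).
Local Notation triplet := (triplet H).
Implicit Types (a b c u v w : word) (k l : triplet) (g h : H).

Definition wchild a : set word := [set c | exists i, c = a ++ [:: i]].

Definition thom k a b := src k = a /\ tgt k = b.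
Definition tid a : triplet := (a, a, 1%g).
Definition tcomp k l : triplet := (src k, tgt l, (lab k * lab l)%g).
Definition tmv k c : word := tgt k ++ [:: last false c].
Definition trs k c : triplet :=
  (c, tmv k c, if last false c then theta (lab k) else lab k).

Lemma last_cat1 a i : last false (a ++ [:: i]) = i.
Proof. by rewrite last_cat. Qed.

Lemma theta1 : theta 1%g = 1%g.
Proof. exact: (thetan1 theta 1). Qed.

Lemma wchild_fin a : finite_set (wchild a).
Proof.
apply: (@sub_finite_set _ _ [set a ++ [:: false]; a ++ [:: true]]).
  by move=> _ [[] ->]; [right|left].
exact: finite_set2.
Qed.

Lemma wchild_uniq a b c : wchild a c -> wchild b c -> a = b.
Proof. by move=> [i ->] [j]; rewrite !cats1 => /rcons_inj[]. Qed.

Lemma wchild_root a : ~ wchild a [::].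
Proof. by move=> [i]; case: a. Qed.

Lemma wbelow a w : below wchild a (a ++ w).
Proof.
elim/last_ind: w => [|w i IH]; first by rewrite cats0; exact: below_refl.
by apply: (below_child IH); exists i; rewrite -cats1 catA.
Qed.

Lemma below_cat a b : below wchild a b -> exists w, b = a ++ w.
Proof.
elim=> [|{}b c _ [w ->] [i ->]]; first by exists [::]; rewrite cats0.
by exists (w ++ [:: i]); rewrite catA.
Qed.

Lemma thom_fin a b : finite_set [set k | thom k a b].
Proof.
apply: (@sub_finite_set _ _ ((fun h => (a, b, h)) @` [set: H])).
  by move=> [[a' b'] h] [/= <- <-]; exists h.
by apply: finite_image; exact: finite_finset.
Qed.

(** An arrow is a triplet; below it, the left child inherits the label and the
    right child its image under [theta], as in the splitting of triplets. *)
Definition VHtree : treeGroupoid.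
Proof.
apply: (@TreeGroupoid word triplet [::] wchild thom tid tcomp (@tripletV H) tmv trs).
- exact: wchild_fin.
- exact: wchild_uniq.
- exact: wchild_root.
- by move=> a; exact: (wbelow [::] a).
- exact: thom_fin.
- by [].
- by move=> k l a b c [<- _] [_ <-].
- by move=> k a b [<- <-].
- by move=> *; rewrite /tcomp /src /tgt /lab /= mulgA.
- by move=> [[a b] h] _ _ [<- _]; rewrite /tcomp /lab /= mul1g.
- by move=> [[a b] h] _ _ [_ <-]; rewrite /tcomp /lab /= mulg1.
- by move=> [[a b] h] _ _ [<- _]; rewrite /tcomp /lab /= mulgV.
- by move=> [[a b] h] _ _ [_ <-]; rewrite /tcomp /lab /= mulVg.
- by move=> k a b c [_ <-] _; exists (last false c).
- by [].
- by move=> a _ [i ->]; rewrite /tmv last_cat1.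
- by move=> a _ [i ->]; rewrite /trs /tmv last_cat1 /lab /= theta1; case: i.
- by move=> k l a b d _ _ _ [i ->]; rewrite /tmv !last_cat1.
- move=> k l a b d _ _ _ [i ->]; rewrite /trs /tcomp /tmv !last_cat1 /lab /=.
  by case: i; rewrite ?gmulfM.
Defined.

(** The triplets of two representatives of [q] agree only after enough
    splittings, so a germ is required to agree with [q] on long words. *)
Definition vgerm (q : VH theta) a b k := thom k a b /\
  exists n, forall w, (n <= size w)%N ->
    vh_ev q (a ++ w) (b ++ w) (thetan theta (count id w) (lab k)).

Lemma ev_fun (s : table H) u v v' g g' : table_ev theta s u v g ->
  table_ev theta s u v' g' -> v = v' /\ g = g'.
Proof.
move=> [t [w [ts eu -> ->]]] [t' [w' [t's eu' -> ->]]].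
by have [-> ->] := part_prefix (src_partition s) ts t's eu eu'.
Qed.

Lemma ev_cat (s : table H) u v g w : table_ev theta s u v g ->
  table_ev theta s (u ++ w) (v ++ w) (thetan theta (count id w) g).
Proof.
move=> [t [r [ts -> -> ->]]]; exists t, (r ++ w); split; rewrite ?catA //.
by rewrite count_cat addnC thetanD.
Qed.

Lemma vgerm_ev q u v g : vh_ev q u v g -> vgerm q u v (u, v, g).
Proof. by move=> h; split=> //; exists 0%N => w _; exact: ev_cat. Qed.

Lemma vgerm_fun q a b b' k k' : vgerm q a b k -> vgerm q a b' k' ->
  b = b' /\ k = k'.
Proof.
case: k k' => [[a1 b1] h] [[a2 b2] h'] [[/= <- <-] [n hn]] [[/= ea <-] [m hm]].
rewrite /src /tgt /lab /= in ea hn hm *; subst a2.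
pose z := nseq (n + m) false.
have cz : count id z = 0%N by rewrite /z count_nseq mul0n.
have := hm z; have := hn z; rewrite size_nseq leq_addr leq_addl cz /=.
move=> /(_ isT) e1 /(_ isT) e2; have [eb ->] := ev_fun e1 e2.
have sb : size b1 = size b2.
  by have := congr1 size eb; rewrite !size_cat => /addIn.
by have [-> _] := cat_eqP sb eb.
Qed.

Lemma vgerm_child q a b k c : vgerm q a b k -> wchild a c ->
  vgerm q c (tmv k c) (trs k c).
Proof.
move=> [[_ eb] [n hn]] [i ->]; split=> //; exists n => w le.
rewrite /trs /tmv last_cat1 -!catA eb /lab /=.
have := hn (i :: w); rewrite /= => /(_ (leqW le)).
by case: i => //; rewrite add1n /thetan iterSr.
Qed.

Lemma vgermM q q' a b c k l : vgerm q a b k -> vgerm q' b c l ->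
  vgerm (q * q')%g a c (tcomp k l).
Proof.
move=> [[ka kb] [n hn]] [[lb lc] [m hm]]; split; first by split.
have [N hN] := vh_evM q q'; exists (n + m + N)%N => w le.
apply/hN; first by rewrite size_cat; apply: leq_trans (leq_addl _ _); apply: leq_trans le; exact: leq_addl.
exists (b ++ w), (thetan theta (count id w) (lab k)), (thetan theta (count id w) (lab l)).
split; last exact: thetanM.
  by apply: hn; apply: leq_trans le; rewrite -addnA leq_addr.
by apply: hm; apply: leq_trans le; rewrite addnAC leq_addl.
Qed.

Lemma vgerm1 : vgerm 1%g [::] [::] (tid [::]).
Proof.
split=> //; have [n hn] := vh_ev_pi theta (table1 H); exists n => w le.
by apply/hn => //; apply/ev_table1; rewrite thetan1.
Qed.

Lemma vh_ev_long (q : VH theta) : exists n, forall u, (n <= size u)%N ->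
  exists v g, @vh_ev _ theta q u v g.
Proof.
exists (maxlen (@src H) (triplets (generic_quotient.repr q))) => u le.
have [t [w [ts eu]]] := part_total (src_partition (generic_quotient.repr q)) le.
exists (tgt t ++ w), (thetan theta (count id w) (lab t)).
by exists t, w.
Qed.

Lemma vgerm_bar q (P : word -> Prop) : (forall a b k, vgerm q a b k -> P a) ->
  (forall a, ~ @leaf VHtree a -> (forall c, wchild a c -> P c) -> P a) -> P [::].
Proof.
move=> base step; have [n hn] := vh_ev_long q.
suff h m u : (n <= size u + m)%N -> P u by apply: (h n); rewrite leq_addl.
elim: m u => [|m IH] u le.
  by have [|v [g /vgerm_ev]] := hn u; [rewrite -(addn0 (size u))|exact: base].
apply: step => [/(_ (u ++ [:: false]))|_ [i ->]].
  by apply; exists false.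
by apply: IH; rewrite size_cat addn1 addSnnS.
Qed.

Definition VHaction : treeAction VHtree (VH theta).
Proof.
apply: (@TreeAction VHtree (VH theta) vgerm) => //.
- by move=> q a b k [].
- exact: vgerm_fun.
- exact: vgerm_child.
- exact: vgerm1.
- exact: vgermM.
- exact: vgerm_bar.
Defined.

(** If [q] sends the subtree of [a] to a proper subtree of it, it sends the child
    of [a] off the path to an incomparable node. *)
Lemma comparable_sibling a i w : ~ (below wchild (a ++ [:: ~~ i]) (a ++ i :: w) \/
  below wchild (a ++ i :: w) (a ++ [:: ~~ i])).
Proof.
by case=> /below_cat[r]; rewrite -catA => /(cat_eqP erefl)[_]; case: i => -[].
Qed.

(** Labels pass unchanged to left children, so an arrow is determined by its
    effect on a singleton block at the left child; hence the parents of
    these blocks are singletons, and all singletons occur by equivariance. *)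
Lemma live_singleton n a (s : arrow VHtree) :
  thom s (@base VHtree a) a -> @live VHtree n a [set s].
Proof.
elim: n a s => // n IH a s hs; right.
pose c := a ++ [:: false]; have ac : wchild a c by exists false.
have [t ht] := @base_hom VHtree c.
have sy : @subblock VHtree a (c, [set t]) by split=> // _ ->.
have [r pr] := @par_nonempty VHtree a (c, [set t]); have [hr er] := pr.
have par1 : @par VHtree a (c, [set t]) = [set r].
  apply/seteqP; split=> [r' [hr' er']|_ -> //].
  have := etrans er' (esym er) => /(congr1 snd) /= /seteqP[h _].
  have [|_ -> /(congr1 (@lab H))] := h (tcomp t (trs (tripletV r') c)); first by exists t.
  rewrite /tcomp /trs /lab /= last_cat1 => /mulgI /invg_inj e.
  by case: r' r hr hr' e {er er' pr h} => [[r1 r2] h] [[r3 r4] h'] /=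
    [<- <-]; rewrite /thom /src /tgt /= => -[-> ->] ->.
have hk := @hom_comp VHtree _ _ _ _ _ (@hom_inv VHtree _ _ _ hr) hs.
set k := acomp _ _ in hk.
exists (@bact VHtree k (c, [set t])); split.
- exact: subblock_act hk sy.
- rewrite (par_act hk sy) par1 /tr image_set1 /k; congr [set _].
  rewrite (@acompA VHtree _ _ _ _ _ _ _ hr (@hom_inv VHtree _ _ _ hr) hs).
  by rewrite (@acompkV VHtree _ _ _ hr) (@acomp1k VHtree _ _ _ hs).
- have [_] := subblock_act hk sy; rewrite /bact /tr image_set1 /= => b1.
  by apply: IH; exact: b1.
Qed.

(** An element fixing all codes fixes nodes by the comparison with siblings, and
    labels because singletons are living blocks. *)
Lemma embeds_VH : embeds (VH theta) thompsonV.
Proof.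
apply: (embeds_tree_action (A := VHaction)) => q fix_q.
have fixn a b k : vgerm q a b k -> a = b.
  move=> gk.
  have cmp c i : vgerm q (c ++ [:: i]) (b ++ [:: i]) (trs k (c ++ [:: i])) ->
      below wchild (c ++ [:: i]) (b ++ [:: i]) \/ below wchild (b ++ [:: i]) (c ++ [:: i]).
    move=> gk'; have [V bV aV] := @alive_exists VHtree (c ++ [:: i]).
    by have [] := fix_q _ _ _ _ gk' bV aV.
  have gi i : vgerm q (a ++ [:: i]) (b ++ [:: i]) (trs k (a ++ [:: i])).
    have [[_ <-] _] := gk; have := vgerm_child gk (ex_intro _ i erefl).
    by rewrite {1}/tmv last_cat1.
  have {}cmp i := cmp a i (gi i).
  have [V bV aV] := @alive_exists VHtree a.
  have [[/below_cat[[|i w] e]|/below_cat[[|i w] e]] _] := fix_q _ _ _ _ gk bV aV;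
    rewrite ?cats0 // in e.
  - by have := cmp (~~ i); rewrite e -catA => /comparable_sibling.
  - by have := cmp (~~ i); rewrite e -catA or_comm => /comparable_sibling.
have fixl u v g : vh_ev q u v g -> v = u /\ g = 1%g.
  move=> /vgerm_ev gk; have e := fixn _ _ _ gk; subst v; split=> //.
  have [s hs] := @base_hom VHtree u.
  have [||_ /(_ erefl)] := fix_q _ _ _ [set s] gk.
  - by move=> _ ->.
  - by move=> n; exact: (live_singleton n hs).
  rewrite /tr image_set1 => /seteqP[/(_ _ erefl) /(congr1 (@lab H))].
  by rewrite /= /tcomp /lab /= => /eqP; rewrite -{2}(mulg1 s.2) => /eqP /mulgI.
apply: vh_ev_inj; have [n hn] := vh_ev_long q; have [m hm] := vh_ev_pi theta (table1 H).
exists (maxn n m) => u; rewrite geq_max => /andP[nu mu] v g; rewrite (hm u mu) ev_table1.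
split=> [/fixl //|[-> ->]]; have [v' [g' h]] := hn u nu.
by have [e1 e2] := fixl _ _ _ h; rewrite e1 e2 in h.
Qed.

End VHtree.

Import Order.TTheory GRing.Theory Num.Theory.

(** * The tree of balls of a compact ultrametric space *)

Lemma below_trans (N : Type) (ch : N -> N -> Prop) a b c :
  below ch a b -> below ch b c -> below ch a c.
Proof. by move=> ab; elim=> // {}b' c' _ IH; exact: below_child. Qed.

Section Balls.
Local Open Scope ring_scope.
Variables (R : realType) (X : ultrametricType R).
Local Notation oball := (openBall X).
Implicit Types (B C D : oball) (x y z : X) (r e : R).

HB.instance Definition _ := gen_eqMixin oball.
HB.instance Definition _ := gen_choiceMixin oball.

Lemma ball_center_eq x z r : ball z r x -> ball x r = ball z r.
Proof.
move=> zx; have r0 : 0 < r.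
  by move: zx; rewrite ballEmdist; exact: le_lt_trans (mdist_ge0 _ _).
have xx : ball x r x by rewrite ballEmdist /= mdistxx.
by apply/seteqP; split; apply: (ball_nested (lexx r) (y := x)).
Qed.

Lemma ball_radius B x : ball_set B x ->
  exists2 r, 0 < r & (B : set X) = ball x r.
Proof.
by have [z [r [r0 ->]]] := ball_setP B => zx; exists r => //; rewrite (ball_center_eq zx).
Qed.

Lemma oball_neq0 B : exists x, ball_set B x.
Proof. by have [z [r [r0 ->]]] := ball_setP B; exists z; exact: ballxx. Qed.

Definition mkball x r (r0 : 0 < r) : oball :=
  OpenBall (ex_intro _ x (ex_intro _ r (conj r0 erefl))).

Lemma ball_apart B x : ~ ball_set B x ->
  exists2 r, 0 < r & forall y, ball x r y -> ~ ball_set B y.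
Proof.
have [z [r [r0 ->]]] := ball_setP B => nx; exists r => // y xy zy.
by apply: nx; rewrite -(ball_center_eq zy) (ball_center_eq xy); exact: ballxx.
Qed.

Definition max_subball B C := [/\ C `<=` B, C <> B
  & forall D, C `<=` D -> D `<=` B -> D = C \/ D = B].

Lemma oball_antisym B C : B `<=` C -> C `<=` B -> B = C.
Proof. by move=> BC CB; apply: openBall_inj; apply/seteqP. Qed.

Lemma max_subball_parent B C D : max_subball B D -> max_subball C D -> B = C.
Proof.
move=> [DB nB mB] [DC nC mC]; have [x Dx] := oball_neq0 D.
have [BC|CB] := openBall_nested (DB _ Dx) (DC _ Dx).
  by have [eBD|//] := mC B DB BC; case: nB.
by have [eCD|->//] := mB C DC CB; case: nC.
Qed.

Lemma max_subball_meet B C D x : max_subball B C -> max_subball B D ->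
  ball_set C x -> ball_set D x -> C = D.
Proof.
move=> [CB nC mC] [DB nD mD] Cx Dx.
have [CD|DC] := openBall_nested Cx Dx.
  by have [->|eDB] := mC D CD DB; [|case: nD].
by have [->|eCB] := mD C DC CB; [|case: nC].
Qed.

Hypothesis cX : compact [set: X].

Lemma ball_cover (r : X -> R) : (forall x, 0 < r x) ->
  exists cs : {fset X}, forall y, exists2 c, c \in cs & ball c (r c) y.
Proof.
move=> r0; pose F := filter_from setT (fun ds : {fset X} => [set cs | ds `<=` cs]%fset).
have FF : Filter F.
  apply: filter_fromT_filter; first by exists fset0.
  move=> i j; exists (i `|` j)%fset => cs /= /fsubsetP sub.
  by split; apply/fsubsetP => x xi; apply: sub; rewrite inE xi ?orbT.
pose P (cs : {fset X}) y := exists2 c, c \in cs & ball c (r c) y.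
have [|ds _ /(_ ds)] := (compact_near_coveringP _).1 cX _ F P FF.
  move=> x _; exists (ball x (r x), [set cs | x \in cs]).
    split=> /=; first exact: nbhsx_ballx.
    by exists [fset x]%fset => // cs /fsubsetP /= sub; apply: sub; rewrite inE.
  by move=> [y cs] [/= xy xcs]; exists x.
by move=> /(_ (fsubset_refl _)) cov; exists ds => y; exact: cov.
Qed.

(** Lebesgue's number lemma, with a finite net at the Lebesgue number. *)
Lemma lebesgue_number (r : X -> R) : (forall x, 0 < r x) ->
  exists (e : R) (cs : {fset X}), [/\ 0 < e,
    forall y, exists2 c, c \in cs & ball c e y
    & forall y, exists x, ball y e `<=` ball x (r x)].
Proof.
move=> r0; have [ds dsP] := ball_cover r0.
pose e := \big[Order.min/1]_(x <- ds) r x.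
have e0 : 0 < e by apply: lt_bigmin => // x _; exact: r0.
have [cs csP] := ball_cover (fun=> e0).
exists e, cs; split=> // y; have [x dx xy] := dsP y; exists x.
have er : e <= r x by exact: ge_bigmin_seq.
by apply: (ball_nested er (y := y)) => //; exact: ballxx.
Qed.

(** The balls that are not small at scale [e]; they are unions of balls of
    radius [e], so they are told apart by the net points they contain. *)
Definition wide e B := forall z, ball_set B z -> ball z e `<=` B.

Lemma wideP e B : 0 < e -> wide e B \/ exists2 z, ball_set B z & B `<=` ball z e.
Proof.
move=> e0; have [|/existsNP[z /not_implyP[Bz nz]]] := pselect (wide e B); [by left|right].
exists z => //; have [|//] := @openBall_nested _ _ B (mkball z e0) z Bz (ballxx z e0).
by [].
Qed.

Lemma wide_sup e x B : 0 < e -> ball x e `<=` B -> wide e B.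
Proof.
move=> e0 xB; have [//|[z Bz Bze]] := wideP B e0; move=> y By.
by rewrite (ball_center_eq (Bze _ By)) -(ball_center_eq (Bze _ (xB _ (ballxx x e0)))).
Qed.

Lemma wide_sub e B C : 0 < e -> wide e C -> C `<=` B -> wide e B.
Proof.
move=> e0 wC CB; have [x Cx] := oball_neq0 C.
by apply: (@wide_sup e x) => // y /(wC _ Cx) /CB.
Qed.

Section Net.
Variables (e : R) (cs : {fset X}).
Hypotheses (e0 : 0 < e) (net : forall y, exists2 c, c \in cs & ball c e y).

Definition net_size B := #|` [fset c in cs | `[< ball_set B c >]]%fset|.

Lemma net_size_lt B C : wide e C -> C `<=` B -> C <> B -> (net_size C < net_size B)%N.
Proof.
move=> wC CB nCB; have wB := wide_sub e0 wC CB.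
have [y By nCy] : exists2 y, ball_set B y & ~ ball_set C y.
  by apply: contrapT => h; apply: nCB; apply: oball_antisym => // y By;
    apply: contrapT => nCy; apply: h; exists y.
have [c cs_c cy] := net y.
apply: fproper_ltn_card; rewrite fproperE; apply/andP; split.
  apply/fsubsetP => x; rewrite !inE /= => /andP[-> /asboolP /CB Bx]; exact/asboolP.
apply/negP => /fsubsetP /(_ c); rewrite !inE cs_c /=.
have Bc : ball_set B c by apply: (wB y By); exact: ball_sym.
by move=> /(_ (asboolT Bc)) /asboolP /wC h; apply: nCy; exact: h.
Qed.

End Net.

(** Among the proper subballs of [B] around [x] that contain the ball of radius
    [mdist x y], one with the most points of a finite net is maximal. *)
Lemma max_subball_exists B x y : ball_set B x -> ball_set B y -> y <> x ->
  exists2 C, max_subball B C & ball_set C x.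
Proof.
move=> Bx By nyx; pose e := mdist x y.
have e0 : 0 < e by rewrite mdist_gt0; apply/eqP => exy; apply: nyx.
have [cs net] := ball_cover (fun=> e0).
pose Q n := `[< exists C, [/\ ball x e `<=` C, C `<=` B, C <> B
  & net_size cs C = n] >].
have [||n /asboolP[C [xC CB nCB eC]] nmax] := @ex_maxnP Q #|` cs|.
- have xy : ~ ball x e y by rewrite ballEmdist /= ltxx.
  exists (net_size cs (mkball x e0)); apply/asboolP; exists (mkball x e0); split=> //.
    have [//|Bxe] := @openBall_nested _ _ (mkball x e0) B x (ballxx x e0) Bx.
    by case: xy; exact: Bxe.
  by move=> E; apply: xy; rewrite -[ball x e]/(ball_set (mkball x e0)) E.
- by move=> n /asboolP[C [_ _ _ <-]]; apply: fsubset_leq_card; exact: fset_sub.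
exists C; last by apply: xC; exact: ballxx.
split=> // D CD DB; have [->|nDB] := pselect (D = B); [by right|left].
apply: contrapT => nDC; have wC := wide_sup e0 xC.
have := net_size_lt e0 net wC CD (fun E => nDC (esym E)).
rewrite eC ltnNge nmax //; apply/asboolP; exists D; split=> //.
exact: subset_trans CD.
Qed.

(** By compactness all children of [B] contain a ball of a common radius, hence a
    point of a finite net, and distinct children are disjoint. *)
Lemma max_subball_fin B : finite_set (max_subball B).
Proof.
have : forall x, exists r, 0 < r /\ ((exists2 C, max_subball B C & (C : set X) = ball x r)
    \/ forall C y, max_subball B C -> ball_set C y -> ~ ball x r y).
  move=> x; have [[C BC Cx]|nC] := pselect (exists2 C, max_subball B C & ball_set C x).
    by have [r r0 er] := ball_radius Cx; exists r; split=> //; left; exists C.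
  have [Bx|nBx] := pselect (ball_set B x); last first.
    have [r r0 hr] := ball_apart nBx; exists r; split=> //; right.
    by move=> C y [CB _ _] /CB By /hr.
  exists 1; split=> //; right=> C y [CB CnB _] Cy _.
  have Bsub z : ball_set B z -> z = x.
    move=> Bz; apply: contrapT => nzx; apply: nC; exact: max_subball_exists Bx Bz nzx.
  apply: CnB; apply: oball_antisym => // z Bz.
  by rewrite (Bsub z Bz) -(Bsub y) //; exact: CB.
move=> /choice[r hr]; have [|e [cs [e0 net leb]]] := @lebesgue_number r.
  by move=> x; have [] := hr x.
have wideC C : max_subball B C -> wide e C.
  move=> BC z Cz; have [x zx] := leb z; have zz := zx _ (ballxx z e0).
  have [_ [[D BD eD]|h]] := hr x; last by case: (h C z).
  by rewrite (max_subball_meet BC BD Cz) ?eD.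
apply: (@sub_finite_set _ _
  ((fun c => xget B [set C | max_subball B C /\ ball_set C c]) @` [set` cs])).
  move=> C BC; have [y Cy] := oball_neq0 C; have [c cs_c cy] := net y.
  have Cc : ball_set C c by apply: (wideC _ BC y Cy); exact: ball_sym.
  exists c => //; apply: xget_unique => [//|D [BD Dc]].
  exact: max_subball_meet BD BC Dc Cc.
by apply: finite_image; exact: finite_fset.
Qed.

(** Induction on balls: by compactness the small balls come for free, and
    only finitely many balls are not small. *)
Lemma ball_bar (P : oball -> Prop) :
  (forall x, exists2 r, 0 < r & forall C, C `<=` ball x r -> P C) ->
  (forall B, (exists C, max_subball B C) -> (forall C, max_subball B C -> P C) -> P B) ->
  forall B, P B.
Proof.
move=> small step B.
have /choice[r hr] : forall x, exists r, 0 < r /\ forall C, C `<=` ball x r -> P C.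
  by move=> x; have [r r0 h] := small x; exists r.
have [|e [cs [e0 net leb]]] := @lebesgue_number r; first by move=> x; have [] := hr x.
have {}small y C : C `<=` ball y e -> P C.
  by move=> Cy; have [x yx] := leb y; apply: (hr x).2; exact: subset_trans yx.
have [n] := ubnP (net_size cs B); elim: n B => // n IH B lt.
have [y By] := oball_neq0 B.
have [/small //|nBy] := pselect (B `<=` ball y e).
apply: step.
  have [z /not_implyP[Bz nyz]] := (existsNP _).2 nBy.
  have [C BC _] : exists2 C, max_subball B C & ball_set C y.
    apply: (max_subball_exists By Bz) => ezy; apply: nyz; rewrite ezy; exact: ballxx.
  by exists C.
move=> C [CB nCB _]; have [wC|[z _ /small //]] := wideP C e0.
by apply: IH; apply: leq_trans (net_size_lt e0 net wC CB _) _ => // e; exact: nCB.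
Qed.

Lemma ball_below B C : B `<=` C -> below max_subball C B.
Proof.
move: C; apply: ball_bar => [x|C _ IH BC].
  have [Bx|nBx] := pselect (ball_set B x).
    have [r r0 er] := ball_radius Bx; exists r => // C Cx BC.
    have -> : C = B by apply: oball_antisym => //; rewrite er.
    exact: below_refl.
  have [r r0 hr] := ball_apart nBx; exists r => // C Cx BC.
  by have [y By] := oball_neq0 B; case: (hr y) => //; apply: Cx; exact: BC.
have [->|nCB] := pselect (C = B); first exact: below_refl.
have [y Cy nBy] : exists2 y, ball_set C y & ~ ball_set B y.
  by apply: contrapT => h; apply: nCB; apply: oball_antisym => // y Cy;
    apply: contrapT => nBy; apply: h; exists y.
have [x Bx] := oball_neq0 B.
have [|D CD Dx] := max_subball_exists (BC _ Bx) Cy; first by move=> eyx; rewrite eyx in nBy.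
apply: (below_trans (below_child (below_refl _ _) CD)).
have [BD|DB] := openBall_nested Bx Dx; first exact: IH.
have [_ _ mD] := CD; have [->|eBC] := mD B DB BC; first exact: below_refl.
by case: nCB.
Qed.

Lemma below_subset B C : below max_subball C B -> B `<=` C.
Proof. by elim=> // D E _ IH [ED _ _]; exact: subset_trans IH. Qed.

Lemma whole_ball x : exists B, (B : set X) = setT.
Proof.
have [cs net] := ball_cover (fun=> ltr01 : 0 < 1 :> R).
pose r := 1 + \sum_(c <- cs) mdist x c.
have r1 : 1 <= r by rewrite lerDl; apply: sumr_ge0 => c _; exact: mdist_ge0.
have r0 : 0 < r by exact: lt_le_trans r1.
exists (mkball x r0); apply/seteqP; split=> // y _ /=; rewrite ballEmdist /=.
have [c cs_c] := net y; rewrite ballEmdist /= => cy.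
apply: le_lt_trans (mdist_ultra x c y) _; rewrite gt_max (lt_le_trans cy r1) andbT.
rewrite /r (big_fsetD1 c cs_c) /= addrCA ltrDl ltr_wpDr //.
by apply: sumr_ge0 => c' _; exact: mdist_ge0.
Qed.

End Balls.

(** * Groups of local similarities *)

Section FSStree.
Local Open Scope ring_scope.
Variables (R : realType) (X : ultrametricType R) (S : finSimStruct X).
Hypothesis cX : compact [set: X].
Variable X0 : openBall X.
Hypothesis X0T : (X0 : set X) = setT.
Local Notation oball := (openBall X).
Implicit Types (a b c B C D : oball) (x y z : X) (k l : set (X * X)).

(** Arrows are graphs of similarities, as subsets of [X * X], which avoids
    functions between varying subtypes. *)
Definition graph B C (h : B -> C) : set (X * X) :=
  [set p | exists x : B, p = (val x, val (h x))].

Definition shom k a b := exists2 h : a -> b, Sim S h & k = graph h.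

Definition srel1 a : set (X * X) := [set p | ball_set a p.1 /\ p.2 = p.1].
Definition srelM k l : set (X * X) := [set p | exists2 y, k (p.1, y) & l (y, p.2)].
Definition srelV k : set (X * X) := [set p | k (p.2, p.1)].
Definition srelI k c : set (X * X) := [set p | ball_set c p.1 /\ k p].
Definition rimage k (A : set X) : set X := [set y | exists2 x, A x & k (x, y)].
Definition smove k c : oball := xget X0 [set D | (D : set X) = rimage k c].

Lemma graphP B C (h : B -> C) x y (Bx : ball_set B x) :
  graph h (x, y) <-> y = val (h (el Bx)).
Proof.
split=> [[x' [ex ->]]|->]; last by exists (el Bx).
by congr (val (h _)); apply: val_inj; rewrite /= ex.
Qed.

Lemma shom_dom k a b x y : shom k a b -> k (x, y) -> ball_set a x.
Proof. by move=> [h _ ->] [x' [-> _]]; exact: set_valP. Qed.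

Lemma shom_codom k a b x y : shom k a b -> k (x, y) -> ball_set b y.
Proof. by move=> [h _ ->] [x' [_ ->]]; exact: set_valP. Qed.

Lemma shom_fun k a b x y z : shom k a b -> k (x, y) -> k (x, z) -> y = z.
Proof.
move=> hk kxy; have ax := shom_dom hk kxy; move: kxy; case: hk => h _ ->.
by move=> /(graphP h _ ax) -> /(graphP h _ ax) ->.
Qed.

Lemma shom_total k a b x : shom k a b -> ball_set a x -> exists y, k (x, y).
Proof.
by move=> [h _ ->] ax; exists (val (h (el ax))); apply/(graphP h _ ax).
Qed.

Lemma shom_id a : shom (srel1 a) a a.
Proof.
exists id; first exact: Sim_id.
apply/seteqP; split=> [[x y] [/= ax ->]|_ [x ->]]; first by exists (el ax).
by split=> //; exact: set_valP.
Qed.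

Lemma shomM k l a b c : shom k a b -> shom l b c -> shom (srelM k l) a c.
Proof.
move=> [h Sh ->] [h' Sh' ->]; exists (h' \o h); first exact: Sim_comp Sh Sh'.
apply/seteqP; split=> [[x z] [y [x' [-> ->]] [y' [ey ->]]]|_ [x ->]].
  have {}ey : h x' = y' by apply: val_inj.
  by exists x'; rewrite /= ey.
by exists (val (h x)); [exists x|exists (h x)].
Qed.

Lemma shomV k a b : shom k a b -> shom (srelV k) b a.
Proof.
move=> [h Sh ->]; have [h' Sh' [hK h'K]] := Sim_inv Sh; exists h' => //.
apply/seteqP; split=> [[y x] [x' /= [-> ->]]|_ [y ->]].
  by exists (h x'); rewrite hK.
by exists (h' y); rewrite /= h'K.
Qed.

Lemma shom_inj k a b x y z : shom k a b -> k (x, z) -> k (y, z) -> x = y.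
Proof. by move=> /shomV hk kx ky; exact: (shom_fun hk kx ky). Qed.

Lemma shom_surj k a b y : shom k a b -> ball_set b y -> exists x, k (x, y).
Proof. by move=> /shomV hk; exact: shom_total hk. Qed.

Lemma rimageV k a b C : shom k a b -> C `<=` a ->
  rimage (srelV k) (rimage k C) = C.
Proof.
move=> hk Ca; apply/seteqP; split=> [x [y [z Cz kzy] kxy]|x Cx].
  by have -> : x = z by exact: (shom_inj hk kxy kzy).
have [y kxy] := shom_total hk (Ca _ Cx).
by exists y => //; exists x.
Qed.

Lemma srelVK k : srelV (srelV k) = k.
Proof. by apply/seteqP; split=> -[]. Qed.

Lemma shom_srelI k a b c : shom k a b -> c `<=` a ->
  (smove k c : set X) = rimage k c /\ shom (srelI k c) c (smove k c).
Proof.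
move=> [h Sh ->] ca; have [d [h' [ed eh' Sh']]] := Sim_restr Sh ca.
have edr : (d : set X) = rimage (graph h) c.
  rewrite ed; apply/seteqP; split=> [_ [x cx <-]|y [x cx [x' [ex ->]]]].
    by exists (val x) => //; exists x.
  by exists x' => //; rewrite /= -ex.
have -> : smove (graph h) c = d.
  by apply: xget_unique => // d' ed'; apply: openBall_inj; rewrite ed' edr.
split=> //; exists h' => //; apply/seteqP; split=> [[x y] [/= cx [x' [ex ->]]]|_ [x ->]].
  by exists (el cx); rewrite -(eh' x' (el cx)) //= ex.
split; first exact: set_valP.
have cx : ball_set c (val x) by exact: set_valP.
by exists (el (ca _ cx)); rewrite (eh' (el (ca _ cx))).
Qed.

Lemma smoveE k a b c : shom k a b -> c `<=` a -> (smove k c : set X) = rimage k c.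
Proof. by move=> hk ca; have [] := shom_srelI hk ca. Qed.

Lemma rimage_sub k a b (A : set X) : shom k a b -> rimage k A `<=` b.
Proof. by move=> hk y [x _]; exact: shom_codom hk. Qed.

Lemma smove_sub k a b c : shom k a b -> c `<=` a -> smove k c `<=` b.
Proof. by move=> hk ca; rewrite (smoveE hk ca); exact: rimage_sub hk. Qed.

Lemma rimageS k (A B : set X) : A `<=` B -> rimage k A `<=` rimage k B.
Proof. by move=> AB y [x Ax kxy]; exists x => //; exact: AB. Qed.

Lemma rimage_dom k a b : shom k a b -> rimage k a = b.
Proof.
move=> hk; apply/seteqP; split; first exact: rimage_sub hk.
move=> y /(shom_surj hk)[x kxy]; exists x => //; exact: shom_dom hk kxy.
Qed.

Lemma max_subball_move k a b c : shom k a b -> max_subball a c -> max_subball b (smove k c).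
Proof.
move=> hk [ca nca mc]; have hV := shomV hk; have em := smoveE hk ca.
have back (d : oball) : d `<=` b -> rimage k (smove (srelV k) d) = d.
  move=> db; rewrite (smoveE hV db) -{1}(srelVK k).
  exact: rimageV hV db.
split; first exact: smove_sub hk ca.
  move=> e; apply: nca; apply: openBall_inj.
  by rewrite -(rimageV hk ca) -em e (rimage_dom hV).
move=> d cd db; have [||e|e] := mc (smove (srelV k) d).
- by rewrite (smoveE hV db) -{1}(rimageV hk ca) -em; exact: rimageS.
- exact: smove_sub hV db.
- by left; apply: openBall_inj; rewrite em -e back.
- by right; apply: openBall_inj; rewrite -(back d db) e (rimage_dom hk).
Qed.

Lemma shom_fin a b : finite_set [set k | shom k a b].
Proof.
apply: (@sub_finite_set _ _ (@graph a b @` @Sim _ _ S a b)).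
  by move=> k [h Sh ->]; exists h.
by apply: finite_image; exact: Sim_finite.
Qed.

Lemma srelMA k l m : srelM k (srelM l m) = srelM (srelM k l) m.
Proof.
apply/seteqP; split=> [[x y] [z kz [t lt mt]]|[x y] [t [z kz lt] mt]].
  by exists t => //; exists z.
by exists z => //; exists t.
Qed.

Lemma srel1M k a b : shom k a b -> srelM (srel1 a) k = k.
Proof.
move=> hk; apply/seteqP; split=> [[x y] [z [_ /= ->]]|[x y] kxy] //.
by exists x => //; split=> //=; exact: shom_dom hk kxy.
Qed.

Lemma srelM1 k a b : shom k a b -> srelM k (srel1 b) = k.
Proof.
move=> hk; apply/seteqP; split=> [[x y] [z kxz [_ /= ->]]|[x y] kxy] //.
by exists y => //; split=> //=; exact: shom_codom hk kxy.
Qed.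

Lemma srelMV k a b : shom k a b -> srelM k (srelV k) = srel1 a.
Proof.
move=> hk; apply/seteqP; split=> [[x y] [z kxz kyz]|[x y] [/= ax ->]].
  by split=> /=; [exact: shom_dom hk kxz|exact: (shom_inj hk kyz kxz)].
by have [z kxz] := shom_total hk ax; exists z.
Qed.

Lemma srelVM k a b : shom k a b -> srelM (srelV k) k = srel1 b.
Proof. by move=> /shomV /srelMV; rewrite srelVK. Qed.

Definition FSStree : treeGroupoid.
Proof.
apply: (@TreeGroupoid oball (set (X * X)) X0 (@max_subball R X)
  shom srel1 srelM srelV smove srelI).
- exact: max_subball_fin cX.
- move=> a b c; exact: max_subball_parent.
- by move=> a [Xa nXa _]; apply: nXa; apply: oball_antisym => //; rewrite X0T.
- by move=> a; apply: (ball_below cX); rewrite X0T.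
- exact: shom_fin.
- exact: shom_id.
- exact: shomM.
- exact: shomV.
- by move=> *; exact: srelMA.
- exact: srel1M.
- exact: srelM1.
- exact: srelMV.
- exact: srelVM.
- exact: max_subball_move.
- by move=> k a b c hk [ca _ _]; have [] := shom_srelI hk ca.
- move=> a c [ca _ _]; apply: openBall_inj; rewrite (smoveE (shom_id a) ca).
  apply/seteqP; split=> [y [x cx [_ /= ->]]|x cx] //.
  by exists x => //; split=> //; exact: ca.
- move=> a c [ca _ _]; apply/seteqP; split=> -[x y] [/= cx]; first by case.
  by move=> ->; split=> //; split=> //; exact: ca.
- move=> k l a b d c hk hl [ca _ _]; apply: openBall_inj.
  rewrite (smoveE (shomM hk hl) ca) (smoveE hl (smove_sub hk ca)) (smoveE hk ca).
  apply/seteqP; split=> [y [x cx [z kz lz]]|y [z [x cx kz] lz]].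
    by exists z => //; exists x.
  by exists x => //; exists z.
- move=> k l a b d c hk hl [ca _ _]; apply/seteqP; split.
    move=> [x y] [/= cx [z kz lz]]; exists z => //; split=> //.
    by rewrite (smoveE hk ca) /=; exists x.
  by move=> [x y] [z [/= cx kz] [_ lz]]; split=> //; exists z.
Defined.

Definition sgerm (g : FSSgroup S) a b k :=
  shom k a b /\ forall x y, k (x, y) -> y = val g x.

Lemma sgerm_restr g a b k c : sgerm g a b k -> c `<=` a ->
  sgerm g c (smove k c) (srelI k c).
Proof.
move=> [hk gk] ca; have [_ hc] := shom_srelI hk ca.
by split=> // x y [_ /gk].
Qed.

Lemma sgerm_fun g a b b' k k' : sgerm g a b k -> sgerm g a b' k' ->
  b = b' /\ k = k'.
Proof.
move=> [hk gk] [hk' gk'].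
have sub m m' c c' : shom m a c -> shom m' a c' ->
    (forall x y, m (x, y) -> y = val g x) ->
    (forall x y, m' (x, y) -> y = val g x) -> m `<=` m'.
  move=> hm hm' gm gm' [x y] mxy; rewrite (gm _ _ mxy).
  have [z m'xz] := shom_total hm' (shom_dom hm mxy).
  by rewrite -(gm' _ _ m'xz).
have e : k = k'.
  by apply/seteqP; split; [exact: (sub _ _ b b')|exact: (sub _ _ b' b)].
by split=> //; apply: openBall_inj; rewrite -(rimage_dom hk) e (rimage_dom hk').
Qed.

Lemma sgerm1 : sgerm 1%g X0 X0 (srel1 X0).
Proof. by split; [exact: shom_id|move=> x y [_ /= ->]]. Qed.

Lemma sgermM g h a b c k l : sgerm g a b k -> sgerm h b c l ->
  sgerm (g * h)%g a c (srelM k l).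
Proof.
move=> [hk gk] [hl gl]; split; first exact: shomM hk hl.
by move=> x y [z /= /gk -> /gl ->].
Qed.

Lemma sgerm_at (g : FSSgroup S) x : exists2 r, 0 < r &
  forall c, c `<=` ball x r -> exists b k, sgerm g c b k.
Proof.
have /asboolP gS := valP g; have [B [B' [h [Bx _ hg Sh]]]] := gS x.
have [r r0 er] := ball_radius Bx; exists r => // c cB; rewrite -er in cB.
have gB : sgerm g B B' (graph h).
  by split; [exists h|move=> y z [y' [-> ->]]; exact: hg].
by exists (smove (graph h) c), (srelI (graph h) c); exact: sgerm_restr gB cB.
Qed.

Definition FSSaction : treeAction FSStree (FSSgroup S).
Proof.
apply: (@TreeAction FSStree (FSSgroup S) sgerm).
- by move=> g a b k [].
- exact: sgerm_fun.
- by move=> g a b k c gk [ca _ _]; exact: sgerm_restr gk ca.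
- exact: sgerm1.
- exact: sgermM.
- move=> g P base step; apply: (ball_bar cX) => [x|B [C BC] IH].
    have [r r0 h] := sgerm_at g x; exists r => // c /h[b [k]]; exact: base.
  by apply: step => // lB; exact: lB BC.
Defined.

(** A point moved by [g] lies in a ball [B] so small that it contains neither
    the image nor the preimage of the point; then [B] and its image are not
    nested. *)
Lemma embeds_FSS_nonempty : embeds (FSSgroup S) thompsonV.
Proof.
apply: (embeds_tree_action (A := FSSaction)) => g fix_g.
apply: val_inj; apply: homeoP => x /=; apply: contrapT => gx.
have gVx : (val g)^-1%g x <> x.
  by move=> e; apply: gx; rewrite -{1}e; exact: homeoVK.
have [r r0 hr] := sgerm_at g x.
pose t := Order.min r (Order.min (mdist x (val g x)) (mdist x ((val g)^-1%g x))).
have t0 : 0 < t.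
  by rewrite !lt_min r0 !mdist_gt0 /=; apply/andP; split; apply/eqP => e;
    [apply: gx|apply: gVx].
have [|b [k gk]] := hr (mkball x t0).
  by move=> y /=; rewrite !ballEmdist /= !lt_min => /andP[].
have [V bV aV] := @alive_exists FSStree (mkball x t0).
have [hk gkE] := gk; have xx : ball_set (mkball x t0) x by exact: ballxx.
have [y kxy] := shom_total hk xx; have ey := gkE _ _ kxy.
have [[/below_subset sub|/below_subset sub] _] := fix_g _ _ _ _ gk bV aV.
  have := sub _ (shom_codom hk kxy).
  by rewrite ey /= ballEmdist /= !lt_min ltxx andbF.
have [z kzx] := shom_surj hk (sub _ xx).
have ez : z = (val g)^-1%g x.
  by rewrite (gkE _ _ kzx); apply/esym; exact: homeoK.
have := shom_dom hk kzx.
by rewrite ez /= ballEmdist /= !lt_min ltxx !andbF.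
Qed.

End FSStree.

Lemma embeds_FSS (R : realType) (X : ultrametricType R) (S : finSimStruct X) :
  compact [set: X] -> embeds (FSSgroup S) thompsonV.
Proof.
move=> cX; have [[x _]|nX] := pselect (exists x : X, True).
  by have [B eB] := whole_ball cX x; exact: (embeds_FSS_nonempty S cX eB).
exists (@one_fun (FSSgroup S) thompsonV) => g h _.
by apply: val_inj; apply: homeoP => x; case: nX; exists x.
Qed.

(** * The two embeddings *)

Theorem theoremB :
  (forall (H : finGroupType) (theta : {multiplicative H -> H}),
     embeds (VH theta) thompsonV) /\
  (forall (R : realType) (X : ultrametricType R) (S : finSimStruct X),
     compact [set: X] -> finitely_many_classes S ->
     embeds (FSSgroup S) thompsonV).
Proof.
split=> [H theta|R X S cX _]; first exact: embeds_VH.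
exact: embeds_FSS.
Qed.
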